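(* Let $T=(T_m)_{m\in\mathbb Z}$ be the (rank-one) $(C,F)$-action of $\mathbb Z$ associated with a sequence $(C_n,F_{n-1})_{n\ge1}$ such that $F_n=\{0,1,\dots,h_n-1\}$ for each $n\ge 0$, and let $\mu$ be the $(C,F)$-measure on the $(C,F)$-space $X$ normalized so that $\mu([0]_0)=1$. Then for all Borel subsets $A,B\subset[0]_0$, $$\lim_{l\to\infty}\frac{\sum_{k=0}^{h_l-1}\mu(A\cap T_kB)}{\sum_{k=0}^{h_l-1}\mu([0]_0\cap T_k[0]_0)}=\mu(A)\mu(B),$$ i.e. $T$ is subsequence weakly rationally ergodic. Hence the rank-one transformations (rank-one $\sigma$-finite measure preserving $\mathbb Z$-actions) are non-squashable.
   Context: **$(C,F)$-construction for $\mathbb Z$.** Let $(F_n)_{n\ge0}$, $(C_n)_{n\ge1}$ be finite subsets of $\mathbb Z$ with: (I) $F_0=\{0\}$, $\#C_n>1$; (II) $F_n+C_{n+1}\subset F_{n+1}$; (III) $(F_n+c)\cap(F_n+c')=\emptyset$ for distinct $c,c'\in C_{n+1}$. Put $X_n=F_n\times C_{n+1}\times C_{n+2}\times\cdots$ (product topology), embed $X_n$ into $X_{n+1}$ by $(f_n,c_{n+1},c_{n+2},\dots)\mapsto(f_n+c_{n+1},c_{n+2},\dots)$, and let $X=\bigcup_nX_n$ be the topological inductive limit (the $(C,F)$-space). For $A\subset F_n$ let $[A]_n=\{(f_n,c_{n+1},\dots)\in X_n: f_n\in A\}$, and $[f]_n=[\{f\}]_n$. The $(C,F)$-measure is the Radon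 measure with $\mu([A]_n)=\#A/(\#C_1\cdots\#C_n)$. For $g\in\mathbb Z$ and $x=(f_n,c_{n+1},\dots)\in X_n$ with $g+f_n\in F_n$ one sets $T_gx=(g+f_n,c_{n+1},\dots)\in X_n$. Standing assumption: for each $g\in \mathbb Z$ and $n>0$, $\lim_{m\to\infty}\frac{\#((g+F_n+C_{n+1}+\cdots+C_m)\cap F_m)}{\#F_n\#C_{n+1}\cdots\#C_m}=1$; this is equivalent to $T_g$ being defined $\mu$-a.e. for every $g$, so $T$ is a $\mu$-preserving $\mathbb Z$-action. **Subsequence weak rational ergodicity.** A conservative ergodic measure preserving $\mathbb Z$-action $T$ on a $\sigma$-finite space $(X,\mathfrak B,\mu)$ has this property if there are an increasing sequence $(h_n)$ of positive integers and a set $Y$ with $0<\mu(Y)<\infty$ such that $\frac1{a_n(Y)}\sum_{k=0}^{h_n-1}\mu(A\cap T_kB)\to\mu(A)\mu(B)$ for all measurable $A,B\subset Y$, where $a_n(Y)=\sum_{k=0}^{h_n-1}\mu(Y\cap T_kY)/\mu(Y)^2$. **Non-squashable**: every nonsingular transformation commuting with $T$ preserves $\mu$. **Rank one**: a measure preserving $\mathbb Z$-action on a standard $\sigma$-finite measure space is of rank one if there are finite-measure sets $B_n$ and integers $h_n$ such that, for each $n$, the sets $T_gB_n$, $0\le g<h_n$, are pairwise disjoint, and for each $B$ with $\mu(B)<\infty$, $\lim_{n}\inf_{F\subset\{0,\dots,h_n-1\}}\mu(B\triangle\bigsqcup_{g\in F}T_gB_n)=0$. *)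

(* Defs.v *)
From HB Require Import structures.
From mathcomp Require Import all_boot all_order all_algebra finmap.
From mathcomp Require Import generic_quotient.
From mathcomp Require Import all_classical all_reals all_analysis.

Set Implicit Arguments.
Unset Strict Implicit.
Unset Printing Implicit Defensive.

Import Order.TTheory GRing.Theory Num.Theory.
Import numFieldNormedType.Exports.

Local Open Scope classical_set_scope.
Local Open Scope ring_scope.

Definition fsumset (A B : {fset int}) : {fset int} :=
  [fset (a + b)%R | a in A, b in B]%fset.

(* [cfC 0] is not used: the sets C_n are indexed by n >= 1. *)
Record cf_data := CFData {
  cfF : nat -> {fset int};
  cfC : nat -> {fset int};
  cfF0 : cfF 0 = [fset 0%R]%fset;
  cfC_gt1 : forall n, (1 < #|` cfC n.+1|)%N;
  cfFC_sub : forall n, (fsumset (cfF n) (cfC n.+1) `<=` cfF n.+1)%fset;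
  cfFC_disj : forall n c c', c \in cfC n.+1 -> c' \in cfC n.+1 -> c != c' ->
    [disjoint fsumset (cfF n) [fset c] & fsumset (cfF n) [fset c']]%fset
}.

Section CFSpace.
Variable D : cf_data.

(* The point (f_n, c_{n+1}, c_{n+2}, ...) of X_n is the sequence x with
   x 0 = f_n and x i.+1 = c_{n+i+1}. The product topology on X_n is the one
   induced by the product of countably many copies of the discrete space Z. *)
Definition cf_level (n : nat) : set {ptws nat -> discrete_topology int} :=
  [set x | x 0%N \in cfF D n /\ forall i, x i.+1 \in cfC D (n + i.+1)].

Definition cf_embed (x : nat -> int) : nat -> int :=
  fun i => if i is j.+1 then x j.+2 else x 0%N + x 1%N.

Definition cf_sum := {n : nat & set_type (cf_level n)}.

(* Two points of the disjoint union of the X_n are identified when they have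
   the same image in some common X_k with k = n + i = m + j. *)
Definition cf_rel (p q : cf_sum) : bool :=
  `[< exists i j, (projT1 p + i = projT1 q + j)%N /\
        iter i cf_embed (\val (projT2 p)) = iter j cf_embed (\val (projT2 q)) >].

Lemma cf_rel_refl : reflexive cf_rel.
Proof. by move=> p; apply/asboolP; exists 0%N, 0%N. Qed.

Lemma cf_rel_sym : symmetric cf_rel.
Proof.
by move=> p q; apply/asboolP/asboolP => -[i [j [e1 e2]]]; exists j, i.
Qed.

Lemma cf_rel_trans : transitive cf_rel.
Proof.
move=> q p r /asboolP[i [j [e1 e2]]] /asboolP[k [l [e3 e4]]].
apply/asboolP; exists (k + i)%N, (j + l)%N; split.
  by rewrite (addnC k) addnA e1 -addnA (addnC j) addnA e3 -addnA (addnC l).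
by rewrite iterD e2 -iterD addnC iterD e4 -iterD.
Qed.

Canonical cf_equiv :=
  EquivRel cf_rel cf_rel_refl cf_rel_sym cf_rel_trans.

(* The topological inductive limit: the quotient topology on the quotient of
   the disjoint union. *)
Definition cf_space := {eq_quot cf_rel}%qT.

HB.instance Definition _ :=
  Topological.copy cf_space (quotient_topology cf_space).
HB.instance Definition _ := Quotient.on cf_space.

Definition cf_pt (n : nat) (x : cf_level n) : cf_space :=
  (\pi_cf_space (existT (fun n => set_type (cf_level n)) n x))%qT.

Lemma cfC_neq0 n : exists c, c \in cfC D n.+1.
Proof. by apply/fset0Pn; rewrite -cardfs_gt0 ltnW// cfC_gt1. Qed.

Definition cf_origin_seq (i : nat) : int :=
  if i is j.+1 then xchoose (cfC_neq0 j) else 0.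

Lemma cf_origin_subproof : cf_origin_seq \in cf_level 0.
Proof.
rewrite inE; split => [|i] /=; first by rewrite cfF0 inE.
exact: xchooseP (cfC_neq0 i).
Qed.

HB.instance Definition _ := isPointed.Build cf_space
  (cf_pt (exist _ cf_origin_seq cf_origin_subproof)).

Definition cf_cyl (n : nat) (A : {fset int}) : set cf_space :=
  [set p | exists x : cf_level n, p = cf_pt x /\ \val x 0%N \in A].

(* [cf_move g p q]: T_g is defined at p and T_g p = q, as read off at some
   level n; that g + f_n lies in F_n is part of y being a point of X_n. *)
Definition cf_move (g : int) (p q : cf_space) : Prop :=
  exists n (x y : cf_level n), [/\ p = cf_pt x, q = cf_pt y,
    \val y 0%N = g + \val x 0%N & forall i, \val y i.+1 = \val x i.+1].

(* The set of the points where every T_g is defined is invariant, and it is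
   conull under [cf_condition] below; extending T_g by the identity off this
   set gives a genuine action of Z. *)
Definition cf_act (g : int) (p : cf_space) : cf_space :=
  if `[< forall g', exists q, cf_move g' p q >]
  then xget p [set q | cf_move g p q] else p.

(* F_n + C_{n+1} + ... + C_{n+k} *)
Fixpoint cf_sumset (n k : nat) : {fset int} :=
  if k is k'.+1 then fsumset (cf_sumset n k') (cfC D (n + k)) else cfF D n.

Definition cf_condition (R : realType) : Prop :=
  forall (g : int) (n : nat), (0 < n)%N ->
    (#|` (fsumset [fset g] (cf_sumset n k) `&` cfF D (n + k))%fset|%:R /
     (#|` cfF D n| * \prod_(n.+1 <= j < (n + k).+1) #|` cfC D j|)%N%:R : R)
      @[k --> \oo] --> (1 : R).

End CFSpace.

Arguments cf_cyl D n A : clear implicits.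
Arguments cf_act D g p : clear implicits.

Notation cf_borel D := (g_sigma_algebraType (@open (cf_space D))).

Definition radon (R : realType) (X : ptopologicalType)
    (mu : {measure set (g_sigma_algebraType (@open X)) -> \bar R}) : Prop :=
  (forall K : set X, compact K -> (mu K < +oo)%E) /\
  (forall A : set (g_sigma_algebraType (@open X)), measurable A ->
     mu A = ereal_sup [set mu K | K in [set K : set X | compact K /\ K `<=` A]]).

(* For n = 0 the product is empty, so that mu [0]_0 = 1. *)
Definition cf_measure (R : realType) (D : cf_data)
    (mu : {measure set (cf_borel D) -> \bar R}) : Prop :=
  radon mu /\
  forall n (A : {fset int}), (A `<=` cfF D n)%fset ->
    mu (cf_cyl D n A) =
      (#|` A|%:R / (\prod_(1 <= j < n.+1) #|` cfC D j|)%N%:R)%:E.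

Section ZActions.
Context {d : measure_display} {X : measurableType d} {R : realType}.
Variables (mu : {measure set X -> \bar R}) (T : int -> X -> X).

Definition mp_action : Prop :=
  [/\ forall g, measurable_fun setT (T g),
      forall x, T 0 x = x,
      forall g h x, T (g + h) x = T g (T h x) &
      forall g A, measurable A -> mu (T g @^-1` A) = mu A].

Definition conservative : Prop :=
  forall W, measurable W -> trivIset setT (fun g : int => T g @` W) ->
    mu W = 0%E.

Definition ergodic : Prop :=
  forall A, measurable A -> (forall g, T g @^-1` A = A) ->
    mu A = 0%E \/ mu (~` A) = 0%E.

(* [fine] sends infinite values to 0; [corr_sum] is only meant for sets of
   finite measure. *)
Definition corr_sum (N : nat) (A B : set X) : R :=
  \sum_(0 <= k < N) fine (mu (A `&` T k%:Z @` B)).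

Definition subseq_weakly_rationally_ergodic : Prop :=
  [/\ mp_action, sigma_finite setT mu, conservative, ergodic &
    exists (h : nat -> nat) (Y : set X),
      let a n := corr_sum (h n) Y Y / fine (mu Y) ^+ 2 in
      [/\ forall n, (0 < h n)%N,
          forall n, (h n < h n.+1)%N,
          measurable Y, (0 < mu Y < +oo)%E &
          forall A B, measurable A -> measurable B -> A `<=` Y -> B `<=` Y ->
            (a n)^-1 * corr_sum (h n) A B @[n --> \oo]
              --> fine (mu A) * fine (mu B)]].

Definition rank_one : Prop :=
  exists (B : nat -> set X) (h : nat -> nat),
    [/\ forall n, measurable (B n) /\ (mu (B n) < +oo)%E,
        forall n, trivIset `I_(h n) (fun g : nat => T g%:Z @` B n) &
        forall A, measurable A -> (mu A < +oo)%E ->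
          ereal_inf [set mu (A `+` \bigcup_(g in F) (T g%:Z @` B n)) |
                      F in [set F : set nat | F `<=` `I_(h n)]]
            @[n --> \oo] --> 0%E].

(* Invertibility is not part of nonsingularity. *)
Definition nonsingular (S : X -> X) : Prop :=
  measurable_fun setT S /\
  forall N, measurable N -> (mu (S @^-1` N) = 0%E <-> mu N = 0%E).

Definition non_squashable : Prop :=
  forall S : X -> X, nonsingular S ->
    (forall g, {ae mu, forall x, S (T g x) = T g (S x)}) ->
    forall A, measurable A -> mu (S @^-1` A) = mu A.

End ZActions.

(* The sigma-algebra of X is the Borel sigma-algebra of a Polish topology. *)
Definition standard_borel (R : realType) (d : measure_display)
    (X : measurableType d) : Prop :=
  exists (P : completePseudoMetricType R) (f : X -> P),
    [/\ bijective f, hausdorff_space P, @second_countable P &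
        forall A : set X, measurable A <-> <<s @open P >> (f @` A)].

(* Main.v *)
Require Import Defs.
From HB Require Import structures.
From mathcomp Require Import all_boot all_order all_algebra finmap.
From mathcomp Require Import generic_quotient.
From mathcomp Require Import all_classical all_reals all_analysis.
From mathcomp Require Import ring lra zify.

Import Order.TTheory GRing.Theory Num.Theory.
Import numFieldNormedType.Exports.

Local Open Scope classical_set_scope.
Local Open Scope ring_scope.

(** For the first part, let Y = [0]_0 and let P_n = [0]_n.  Up to a null set Y is
    the union of N_n = #C_1...#C_n levels T_j P_n of the n-th tower.  Moving a
    level along the tower only shifts the window of summation, so for fixed n the
    sums of mu(T_i P_n /\ T_k T_j P_n) over k < h_l agree for all levels i, j up to
    an error independent of l.  As the sum s_l of mu(Y /\ T_k Y) over k < h_l is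
    at least N_l / 2, it diverges, and the ratio tends to 1 / N_n^2 on pairs of
    levels.  As a window of length h_l meets each level of the l-th tower at most
    once, the sum for A, B in Y is at most N_l mu(A) <= 2 s_l mu(A), and likewise
    with mu(B); this uniform bound carries the limit over from finite unions of
    levels to Borel sets.  Conservativity and ergodicity follow from the limit.

    For the second part, let S commute with T, let B_n be the rank-one bases and
    put Q_n = S^-1 B_n.  Then T_g Q_n, g < h_n, is a tower too, and counting visits
    of a window of length h_n gives, for a union U of levels of the tower over B_n,
    mu(S^-1 U /\ tower(B_n)) <= mu(U) and mu(U /\ tower(Q_n)) <= mu(S^-1 U).
    Both towers exhaust X in measure, whence mu(S^-1 Y) <= mu(Y) <= mu(S^-1 Y). *)

(** * Towers *)

(** The second part is not deduced from the first: the towers given by [rank_one] need not be nested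
    and nothing relates successive bases, whereas the ratio limit rests on one set being a union of
    levels of every tower. The comparison of S^-1 Y with Y therefore uses a single tower at a time.
    As [S] may be non-invertible and the pullback of [mu] along [S] is not known to be sigma-finite,
    no density is used; nonsingularity enters through its epsilon-delta form on sets of finite
    measure, which carries approximation errors through [S]. The inequality mu(S^-1 Y) <= mu(Y) has
    to come before its converse, which uses it to control the preimage of an error set.

    In the first part the action is the identity off a conull set of good points, and there the
    translates of a cylinder would overlap; so cylinders are cut down to good points. The counting
    is done for an abstract action with towers. The factor 1/2 in the lower bound N_l / 2 arises
    because, in a window starting at 0, a level is only sure to reach the levels above it. *)

Section Action.
Context {d : measure_display} {X : measurableType d} {R : realType}.
Variables (mu : {measure set X -> \bar R}) (T : int -> X -> X).
Hypothesis actT : mp_action mu T.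

Lemma actD g h x : T (g + h) x = T g (T h x).
Proof. by have [_ _ + _] := actT; exact. Qed.

Lemma act0 x : T 0 x = x.
Proof. by have [_ + _ _] := actT; exact. Qed.

Lemma actK g x : T (- g) (T g x) = x.
Proof. by rewrite -actD addNr act0. Qed.

Lemma actNK g x : T g (T (- g) x) = x.
Proof. by rewrite -actD addrN act0. Qed.

Lemma act_imageE g A : T g @` A = T (- g) @^-1` A.
Proof.
apply/seteqP; split => [_ [x Ax <-]|x Ax]; first by rewrite /= actK.
by exists (T (- g) x) => //; rewrite actNK.
Qed.

Lemma measurable_act_image g A : measurable A -> measurable (T g @` A).
Proof.
move=> mA; rewrite act_imageE -[_ @^-1` _]setTI.
by have [mT _ _ _] := actT; exact: mT.
Qed.

Lemma measure_act_image g A : measurable A -> mu (T g @` A) = mu A.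
Proof. by move=> mA; rewrite act_imageE; have [_ _ _ ->] := actT. Qed.

Lemma act_image_comp g h A : T g @` (T h @` A) = T (g + h) @` A.
Proof.
rewrite !act_imageE opprD addrC.
by apply/seteqP; split => x /=; rewrite actD.
Qed.

Lemma act_image0 A : T 0 @` A = A.
Proof. by rewrite act_imageE oppr0; apply/seteqP; split => x /=; rewrite act0. Qed.

Lemma act_imageI g A B : T g @` (A `&` B) = T g @` A `&` T g @` B.
Proof. by rewrite !act_imageE preimage_setI. Qed.

Definition is_tower (h : nat) (P : set X) :=
  trivIset `I_h (fun g : nat => T g%:Z @` P).

Lemma is_tower_shift h P i : is_tower h P -> is_tower h (T i @` P).
Proof.
move=> tP; apply/trivIsetP => g k Ig Ik gk; move/trivIsetP: tP => /(_ g k Ig Ik gk).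
rewrite !act_image_comp (addrC _ i) (addrC _ i) -!act_image_comp -act_imageI => ->.
by rewrite image_set0.
Qed.

(** Translating by -(g + k) sends T_k P /\ T_g P to T_(-g) P /\ T_(-k) P. Backward translates occur
    as soon as visits are counted inside the base instead of along the window. *)
Lemma is_tower_opp h P : is_tower h P ->
  trivIset `I_h (fun g : nat => T (- g%:Z) @` P).
Proof.
move=> tP; apply/trivIsetP => g k Ig Ik gk.
move/trivIsetP: tP => /(_ k g Ik Ig); rewrite eq_sym => /(_ gk).
move=> /(congr1 (image^~ (T (- (g%:Z + k%:Z))))).
rewrite act_imageI image_set0 !act_image_comp opprD subrK.
by rewrite (addrC (- _)) subrK.
Qed.

Lemma measurable_act_bigcup (D : set nat) P : measurable P ->
  measurable (\bigcup_(g in D) (T g%:Z @` P)).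
Proof.
by move=> mP; apply: bigcup_measurable => k _; exact: measurable_act_image.
Qed.

(* A window of length h meets a base of an h-tower at most once. *)
Lemma measure_tower_setI h P Q : measurable P -> measurable Q ->
  is_tower h P -> is_tower h Q ->
  (mu (Q `&` \bigcup_(g in `I_h) (T g%:Z @` P)) <= mu P)%E.
Proof.
move=> mP mQ tP tQ; rewrite setI_bigcupr measure_bigcup; last 2 first.
- by move=> g _; apply: measurableI => //; exact: measurable_act_image.
- by apply: trivIset_setIl.
rewrite (eq_eseriesr (g := fun g : nat => mu (T (- g%:Z) @` Q `&` P))); last first.
  move=> g _ ; rewrite -[in RHS](act_image0 P) -(addNr g%:Z) -act_image_comp -act_imageI.
  by rewrite measure_act_image//; apply: measurableI => //; exact: measurable_act_image.
rewrite -measure_bigcup; last 2 first.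
- by move=> g _; apply: measurableI => //; exact: measurable_act_image.
- by apply: trivIset_setIr; exact: is_tower_opp.
rewrite -setI_bigcupl; apply: measureIr => //.
by apply: bigcup_measurable => k _; exact: measurable_act_image.
Qed.

(* Symmetric in P and Q: it is used with S^-1 P in place of Q, and then with the
   roles of P and S^-1 P exchanged. *)
Lemma measure_tower_exchange h P Q F : measurable P -> measurable Q ->
  is_tower h P -> is_tower h Q -> F `<=` `I_h ->
  (mu (\bigcup_(i in F) (T i%:Z @` Q) `&` \bigcup_(g in `I_h) (T g%:Z @` P)) <=
   mu (\bigcup_(i in F) (T i%:Z @` P)))%E.
Proof.
move=> mP mQ tP tQ Fh; rewrite setI_bigcupl measure_bigcup; last 2 first.
- move=> g _; apply: measurableI; first exact: measurable_act_image.
  exact: measurable_act_bigcup.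
- by apply: trivIset_setIr; exact: sub_trivIset tQ.
rewrite [leRHS]measure_bigcup; last 2 first.
- by move=> g _; exact: measurable_act_image.
- exact: sub_trivIset tP.
apply: lee_nneseries => // i _.
rewrite measure_act_image//; apply: measure_tower_setI => //.
  exact: measurable_act_image.
exact: is_tower_shift.
Qed.

End Action.

(** * Non-squashability *)

Lemma le_measure_null {d} {X : measurableType d} {R : realType}
    (mu : {measure set X -> \bar R}) (A B N : set X) :
  measurable A -> measurable B -> measurable N -> mu N = 0%E -> A `<=` B `|` N ->
  (mu A <= mu B)%E.
Proof.
move=> mA mB mN N0 AB; rewrite -[leRHS](measureU0 mB mN N0).
by apply: le_measure; rewrite ?inE//; exact: measurableU.
Qed.

(** Finiteness of [nu] is what upgrades domination of null sets to a uniform statement. It is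
    obtained by viewing [nu] as a charge and bounding it by its variation. *)
Lemma finite_measure_abs_continuous {d} {X : measurableType d} {R : realType}
    (mu : {measure set X -> \bar R}) (nu : {finite_measure set X -> \bar R}) :
  (forall A, measurable A -> mu A = 0%E -> nu A = 0%E) ->
  forall e : R, 0 < e -> exists2 dlt : R, 0 < dlt &
    forall A, measurable A -> (mu A < dlt%:E)%E -> (nu A < e%:E)%E.
Proof.
move=> numu e e0.
have [P [N PN]] := Hahn_decomposition (charge_of_finite_measure nu).
have nudom : charge_of_finite_measure nu `<< mu.
  by apply/null_content_dominatesP => A mA; exact: numu.
have [dlt [dlt0 H]] := charge_variation_continuous PN nudom e0.
exists dlt => // A mA /(H A mA); apply: le_lt_trans.
apply: le_trans (abse_charge_variation PN mA).
exact: lee_abs.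
Qed.

Lemma pullback_measure {d} {X : measurableType d} {R : realType}
    (mu : {measure set X -> \bar R}) (S : X -> X) (Z : set X) :
  measurable_fun setT S -> measurable Z ->
  exists nu : {measure set X -> \bar R}, forall A, nu A = mu (S @^-1` A `&` Z).
Proof.
move=> mS mZ.
by unshelve eexists (pushforward (mrestr mu mZ) S : {measure set X -> \bar R}).
Qed.

(** The measure A |-> mu(S^-1 A) may a priori be infinite on small sets; intersecting with [Z] of
    finite measure makes it finite, so that absolute continuity becomes uniform. *)
Lemma pullback_abs_continuous {d} {X : measurableType d} {R : realType}
    (mu : {measure set X -> \bar R}) (S : X -> X) (Z : set X) :
  nonsingular mu S -> measurable Z -> (mu Z < +oo)%E ->
  forall e : R, 0 < e -> exists2 dlt : R, 0 < dlt &
    forall A, measurable A -> (mu A < dlt%:E)%E -> (mu (S @^-1` A `&` Z) < e%:E)%E.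
Proof.
move=> [mS nsS] mZ Zoo.
have [m1 m1E] := pullback_measure mu S Z mS mZ.
have m1T : (m1 setT < +oo)%E by rewrite m1E preimage_setT setTI.
have m2E A : mfrestr measurableT m1T A = mu (S @^-1` A `&` Z).
  exact: etrans (congr1 m1 (setIT A)) (m1E A).
move=> e e0; have [A mA A0|dlt dlt0 H] :=
  finite_measure_abs_continuous mu (mfrestr measurableT m1T) _ e e0.
  have mSA : measurable (S @^-1` A) by rewrite -[_ @^-1` _]setTI; exact: mS.
  apply: etrans (m2E A) _.
  apply: (@subset_measure0 _ _ _ mu _ (S @^-1` A)) => //.
    exact: measurableI.
  exact/nsS.
by exists dlt => // A mA /(H A mA); apply: le_lt_trans; rewrite -m2E.
Qed.

Lemma measure_le_exhaustion {d} {X : measurableType d} {R : realType}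
    (mu : {measure set X -> \bar R}) (Z : nat -> set X) (A : set X) (c : \bar R) :
  (forall k, measurable (Z k)) -> {homo Z : n m / (n <= m)%N >-> (n <= m)%O} ->
  \bigcup_k Z k = setT -> measurable A ->
  (forall k, (mu (A `&` Z k) <= c)%E) -> (mu A <= c)%E.
Proof.
move=> mZ ndZ ZT mA Ac.
have mAZ k : measurable (A `&` Z k) by exact: measurableI.
have AE : \bigcup_k (A `&` Z k) = A by rewrite -setI_bigcupr ZT setIT.
have Acv := nondecreasing_cvg_mu (mu := mu) mAZ.
rewrite AE in Acv.
rewrite -(cvg_lim _ (Acv mA _))//; last first.
  move=> n m nm; rewrite subsetEset; apply: setIS; rewrite -subsetEset; exact: ndZ.
apply: lime_le; last by apply: nearW => k; exact: Ac.
apply/cvg_ex; eexists; apply: Acv => //.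
by move=> n m nm; rewrite subsetEset; apply: setIS; rewrite -subsetEset; exact: ndZ.
Qed.

Lemma measure_exhaustion_small {d} {X : measurableType d} {R : realType}
    (mu : {measure set X -> \bar R}) (Z : nat -> set X) (A : set X) (e : R) :
  (forall k, measurable (Z k)) -> {homo Z : n m / (n <= m)%N >-> (n <= m)%O} ->
  \bigcup_k Z k = setT -> measurable A -> (mu A < +oo)%E -> 0 < e ->
  \forall k \near \oo, (mu (A `\` Z k) < e%:E)%E.
Proof.
move=> mZ ndZ ZT mA Aoo e0.
have AE : \bigcap_k (A `\` Z k) = set0.
  rewrite -subset0 => x Ax; have [k _ Zkx] : (\bigcup_k Z k) x by rewrite ZT.
  by have [] := Ax k I.
have mAZ k : measurable (A `\` Z k) by exact: measurableD.
have := nonincreasing_cvg_mu (mu := mu) (F := fun k => A `\` Z k).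
rewrite AE measure0 => H.
have /H {}H : (mu (A `\` Z 0%N) < +oo)%E.
  by apply: le_lt_trans Aoo; apply: le_measure; rewrite ?inE//; exact: subDsetl.
have {}H : (mu (A `\` Z k) @[k --> \oo] --> (0:R)%:E)%E.
  apply: H => // n m nm; rewrite subsetEset; apply: setDS.
  by rewrite -subsetEset; exact: ndZ.
exact: (H _ (open_ereal_lt' (_ : (0%:E < e%:E)%E))).
Qed.

Section NonSquashable.
Context {d : measure_display} {X : measurableType d} {R : realType}.
Variables (mu : {measure set X -> \bar R}) (T : int -> X -> X).
Hypothesis actT : mp_action mu T.

(** The union of all T_g A_k, with A_k a null measurable cover of N_k, is invariant, and null
    because pairs of integers are countable. The default value of [e] is harmless: every pair is
    reached through its code. *)
Lemma null_orbit_closure (N : int -> set X) :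
  (forall g, mu.-negligible (N g)) ->
  exists M, [/\ measurable M, mu M = 0%E, forall g, N g `<=` M &
    forall g x, M x -> M (T g x)].
Proof.
move=> /choice[A HA].
pose e (n : nat) : int * int := odflt (0, 0) (choice.unpickle n).
have eK p : e (choice.pickle p) = p by rewrite /e choice.pickleK.
pose M := \bigcup_n (T (e n).1 @` A (e n).2).
have mA n : measurable (T (e n).1 @` A (e n).2).
  by apply: (measurable_act_image _ _ actT); have [] := HA (e n).2.
have mM : measurable M by exact: bigcupT_measurable.
exists M; split => //.
- apply/negligibleP => //; apply: negligible_bigcup => n; apply/negligibleP => //.
  have [mAn An0 _] := HA (e n).2.
  exact: etrans (measure_act_image _ _ actT _ _ mAn) An0.
- move=> g x Nx; exists (choice.pickle (0%Z : int, g)) => //; rewrite eK (act_image0 _ _ actT).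
  by have [_ _] := HA g; exact.
- move=> g x [n _ [y Ay <-]]; exists (choice.pickle (g + (e n).1, (e n).2)) => //.
  by rewrite eK /=; exists y => //; rewrite (actD _ _ actT).
Qed.

Variable S : X -> X.
Hypotheses (nsS : nonsingular mu S)
  (STae : forall g, {ae mu, forall x, S (T g x) = T g (S x)}).

Let measurable_preimage A : measurable A -> measurable (S @^-1` A).
Proof. by move=> mA; rewrite -[_ @^-1` _]setTI; have [mS _] := nsS; exact: mS. Qed.

(** Commutation holds only almost everywhere, but towers need exact disjointness. Removing one
    invariant null set containing all the exceptional points makes S^-1 commute with every T_g as an
    identity of sets. *)
Lemma commuting_pullback_tower : exists N, [/\ measurable N, mu N = 0%E,
  (forall g B, T g @` (S @^-1` B `\` N) = S @^-1` (T g @` B) `\` N) &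
  (forall A, measurable A -> mu (S @^-1` A `\` N) = mu (S @^-1` A))].
Proof.
have [N [mN N0 bad Ninv]] := null_orbit_closure _ STae.
exists N; split => //.
- move=> g B; rewrite !(act_imageE _ _ actT); apply/seteqP; split => x /= [Bx nNx].
    split; last by move=> Nx; apply: nNx; exact: Ninv.
    have -> : T (- g) (S x) = S (T (- g) x) => //.
    apply: contrapT => Sx; apply: nNx; apply: Ninv; apply: (bad (- g) x).
    by move=> /esym.
  split; last by move/(Ninv g); rewrite (actNK _ _ actT).
  have -> : S (T (- g) x) = T (- g) (S x) => //.
  by apply: contrapT => Sx; apply: nNx; exact: (bad (- g) x Sx).
- move=> A /measurable_preimage mA; rewrite (measureDI mu mA mN).
  rewrite [X in (_ = _ + X)%E](_ : _ = 0%E) ?adde0//.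
  by apply: (subset_measure0 _ mN) N0 => //; exact: measurableI.
Qed.

Let pullback_tower_le (B : set X) (h : nat) F : measurable B -> is_tower T h B ->
  F `<=` `I_h ->
  (mu (S @^-1` (\bigcup_(g in F) (T g%:Z @` B)) `&` \bigcup_(g in `I_h) (T g%:Z @` B))
   <= mu (\bigcup_(g in F) (T g%:Z @` B)))%E /\
  (mu (\bigcup_(g in F) (T g%:Z @` B) `&` S @^-1` (\bigcup_(g in `I_h) (T g%:Z @` B)))
   <= mu (S @^-1` (\bigcup_(g in F) (T g%:Z @` B))))%E.
Proof.
move=> mB tB Fh.
have [N [mN N0 SN muN]] := commuting_pullback_tower.
pose Q := S @^-1` B `\` N.
have mQ : measurable Q by apply: measurableD => //; exact: measurable_preimage.
have UQ G : \bigcup_(g in G) (T g%:Z @` Q) = S @^-1` (\bigcup_(g in G) (T g%:Z @` B)) `\` N.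
  rewrite preimage_bigcup setDE setI_bigcupl.
  by apply: eq_bigcupr => g _; rewrite SN setDE.
have tQ : is_tower T h Q.
  apply/trivIsetP => g k Ig Ik gk; rewrite !SN.
  move/trivIsetP: tB => /(_ g k Ig Ik gk) gk0.
  rewrite -subset0 => x [[Sg _] [Sk _]].
  have [] : set0 (S x).
  by rewrite -gk0; split; [exact: Sg|exact: Sk].
have mU G := measurable_act_bigcup _ _ actT G _ mB.
have mSU G := measurable_preimage _ (mU G).
split.
- have := measure_tower_exchange _ _ actT h _ _ F mB mQ tB tQ Fh.
  apply: le_trans; rewrite UQ; apply: (le_measure_null _ _ _ N) => //.
  - exact: measurableI.
  - by apply: measurableI => //; exact: measurableD.
  - move=> x [Sx tx]; have [Nx|nNx] := pselect (N x); by [right|left].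
- have := measure_tower_exchange _ _ actT h _ _ F mQ mB tQ tB Fh.
  rewrite !UQ muN//; apply: le_trans; apply: (le_measure_null _ _ _ N) => //.
  - exact: measurableI.
  - by apply: measurableI => //; exact: measurableD.
  - move=> x [Ux Sx]; have [Nx|nNx] := pselect (N x); by [right|left].
Qed.

Hypotheses (sfX : sigma_finite setT mu) (r1T : rank_one mu T).

Lemma rank_one_approx : exists (B : nat -> set X) (h : nat -> nat),
  [/\ forall n, measurable (B n), forall n, is_tower T (h n) (B n) &
    forall A e, measurable A -> (mu A < +oo)%E -> 0 < e ->
      \forall n \near \oo, exists2 F, F `<=` `I_(h n) &
        (mu (A `+` \bigcup_(g in F) (T g%:Z @` B n)) < e%:E)%E].
Proof.
have [B [h [mB tB apx]]] := r1T; exists B, h; split => //.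
  by move=> n; have [] := mB n.
move=> A e mA Aoo e0.
have e0' : (0%:E < e%:E)%E by rewrite lte_fin.
have [N _ HN] := apx A mA Aoo _ (open_ereal_lt' e0').
by exists N => // n /HN /ereal_inf_lt[_ [F FI <-] Fe]; exists F.
Qed.

Let setY_small A B (e : R) : measurable A -> measurable B -> (mu (A `+` B) < e%:E)%E ->
  (mu (A `\` B) < e%:E)%E /\ (mu (B `\` A) < e%:E)%E.
Proof.
move=> mA mB; rewrite setY_def => ABe.
by split; apply: le_lt_trans ABe; apply: le_measure; rewrite ?inE//;
  do ?[exact: mA|exact: mB|apply: measurableU|apply: measurableD].
Qed.

Let measure_leD A B : measurable A -> measurable B -> (mu A <= mu (A `\` B) + mu B)%E.
Proof.
move=> mA mB; rewrite {1}(measureDI mu mA mB) leeD2l//.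
by apply: le_measure; rewrite ?inE//; exact: measurableI.
Qed.

Let measure_subU A B C : measurable A -> measurable B -> measurable C -> A `<=` B `|` C ->
  (mu A <= mu B + mu C)%E.
Proof.
move=> mA mB mC ABC; apply: le_trans (measureU2 mu mB mC).
by apply: le_measure; rewrite ?inE//; exact: measurableU.
Qed.

(** With U a union of levels close to Y and W the whole tower, the part of S^-1 Y in Z_k lies in
    S^-1 (Y \ U), in Z_k \ W or in S^-1 U /\ W. The first is small by absolute continuity on Z_k,
    the second because the tower fills Z_k, and the third is at most mu(U) by counting. *)
Lemma commuting_le Y : measurable Y -> (mu Y < +oo)%E -> (mu (S @^-1` Y) <= mu Y)%E.
Proof.
move=> mY Yoo.
have [B [h [mB tB apx]]] := rank_one_approx.
have /sigma_finiteP[Z [ZT ndZ mZ]] := sfX.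
apply: (measure_le_exhaustion mu Z) => //;
  [by move=> k; have [] := mZ k|exact: measurable_preimage|].
move=> k; have [mZk Zkoo] := mZ k.
apply/lee_addgt0Pr => e e0.
have e30 : 0 < e / 3 by rewrite divr_gt0.
have [dlt dlt0 small] := pullback_abs_continuous mu S (Z k) nsS mZk Zkoo _ e30.
(* The same approximation must be small in measure and small enough to have a small preimage in
   Z_k. *)
pose r := Num.min (e / 3) dlt.
have r0 : 0 < r by rewrite lt_min e30 dlt0.
have [n [[F Fh UY] [G Gh UZ]]] : exists n, (exists2 F, F `<=` `I_(h n) &
     (mu (Y `+` \bigcup_(g in F) (T g%:Z @` B n)) < r%:E)%E) /\
   (exists2 F, F `<=` `I_(h n) &
     (mu (Z k `+` \bigcup_(g in F) (T g%:Z @` B n)) < r%:E)%E).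
  apply: (@filter_ex _ \oo); apply: filterI; exact: apx.
have mU D := measurable_act_bigcup _ _ actT D _ (mB n).
have [H1 _] := pullback_tower_le _ _ _ (mB n) (tB n) Fh.
set U := \bigcup_(g in F) _ in UY H1.
set W := \bigcup_(g in `I_(h n)) _ in H1.
have [YU UY'] := setY_small _ _ _ mY (mU F) UY.
have [ZV _] := setY_small _ _ _ mZk (mU G) UZ.
have mU' : measurable U := mU F.
have mW : measurable W := mU _.
have mSU := measurable_preimage _ mU'.
have mSYU : measurable (S @^-1` (Y `\` U)) by apply: measurable_preimage; exact: measurableD.
have -> : (e = e / 3 + e / 3 + e / 3)%R by lra.
have small1 : (mu (S @^-1` (Y `\` U) `&` Z k) <= (e / 3)%:E)%E.
  apply/ltW/small; first exact: measurableD.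
  by apply: lt_le_trans YU _; rewrite lee_fin ge_min lexx orbT.
have small2 : (mu (Z k `\` W) <= (e / 3)%:E)%E.
  apply: (@le_trans _ _ (mu (Z k `\` \bigcup_(g in G) (T g%:Z @` B n)))).
    apply: le_measure; rewrite ?inE; [exact: measurableD|apply: measurableD => //; exact: mU|].
    by apply: setDS; exact: bigcup_subset.
  by apply: le_trans (ltW ZV) _; rewrite lee_fin ge_min lexx.
have small3 : (mu U <= mu Y + (e / 3)%:E)%E.
  rewrite addeC; apply: le_trans (measure_leD _ _ mU' mY) _; apply: leeD => //.
  by apply: le_trans (ltW UY') _; rewrite lee_fin ge_min lexx.
have step1 : (mu (S @^-1` Y `&` Z k) <=
    mu (S @^-1` (Y `\` U) `&` Z k) + mu (S @^-1` U `&` Z k))%E.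
  apply: measure_subU; try by apply: measurableI => //; exact: measurable_preimage.
  move=> x [SY Zx]; have [Ux|nUx] := pselect (U (S x)); [by right|by left].
have step2 : (mu (S @^-1` U `&` Z k) <= mu (Z k `\` W) + mu (S @^-1` U `&` W))%E.
  apply: measure_subU; [exact: measurableI|exact: measurableD|exact: measurableI|].
  move=> x [SU Zx]; have [Wx|nWx] := pselect (W x); [by right|by left].
apply: le_trans step1 _; rewrite 2!EFinD.
rewrite -(addeA (e / 3)%:E) !(addeCA (mu Y)).
apply: leeD => //; apply: le_trans step2 _; apply: leeD => //.
exact: le_trans H1 small3.
Qed.

(** Four errors of e / 4: Y \ U, the part of Y mapped outside Z_k, the part of Y mapped into Z_k \
    W, and the passage from S^-1 U back to S^-1 Y. What remains lies in U /\ S^-1 W and is bounded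
    by counting. *)
Lemma commuting_ge Y : measurable Y -> (mu Y < +oo)%E -> (mu Y <= mu (S @^-1` Y))%E.
Proof.
move=> mY Yoo.
have [B [h [mB tB apx]]] := rank_one_approx.
have /sigma_finiteP[Z [ZT ndZ mZ]] := sfX.
apply/lee_addgt0Pr => e e0.
have e40 : 0 < e / 4 by rewrite divr_gt0.
have [dlt dlt0 small] := pullback_abs_continuous mu S Y nsS mY Yoo _ e40.
pose r := Num.min (e / 4) dlt.
have r0 : 0 < r by rewrite lt_min e40 dlt0.
(* Towers approximate only sets of finite measure, so S^-1 W is compared with S^-1 Z_k for a large
   k; these preimages exhaust X. *)
have [k YZ] : exists k, (mu (Y `\` S @^-1` (Z k)) < (e / 4)%:E)%E.
  apply: (@filter_ex _ \oo); apply: measure_exhaustion_small => //.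
  - by move=> k; apply: measurable_preimage; have [] := mZ k.
  - by move=> n m nm; rewrite subsetEset; apply: preimage_subset;
      rewrite -subsetEset; exact: ndZ.
  - by rewrite -preimage_bigcup -ZT preimage_setT.
have [mZk Zkoo] := mZ k.
have [n [[F Fh UY] [G Gh UZ]]] : exists n, (exists2 F, F `<=` `I_(h n) &
     (mu (Y `+` \bigcup_(g in F) (T g%:Z @` B n)) < r%:E)%E) /\
   (exists2 F, F `<=` `I_(h n) &
     (mu (Z k `+` \bigcup_(g in F) (T g%:Z @` B n)) < r%:E)%E).
  apply: (@filter_ex _ \oo); apply: filterI; exact: apx.
have mU D := measurable_act_bigcup _ _ actT D _ (mB n).
have [_ H1] := pullback_tower_le _ _ _ (mB n) (tB n) Fh.
set U := \bigcup_(g in F) _ in UY H1.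
set W := \bigcup_(g in `I_(h n)) _ in H1.
have [YU UY'] := setY_small _ _ _ mY (mU F) UY.
have [ZV _] := setY_small _ _ _ mZk (mU G) UZ.
have mU' : measurable U := mU F.
have mW : measurable W := mU _.
have mZW : measurable (Z k `\` W) by exact: measurableD.
have -> : (e = e / 4 + (e / 4 + (e / 4 + e / 4)))%R by lra.
have small1 : (mu (S @^-1` (Z k `\` W) `&` Y) <= (e / 4)%:E)%E.
  apply/ltW/small => //.
  apply: (@le_lt_trans _ _ (mu (Z k `\` \bigcup_(g in G) (T g%:Z @` B n)))).
    apply: le_measure; rewrite ?inE; [exact: measurableD|apply: measurableD => //; exact: mU|].
    by apply: setDS; exact: bigcup_subset.
  by apply: lt_le_trans ZV _; rewrite lee_fin ge_min lexx orbT.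
have small3 : (mu (S @^-1` U) <= (e / 4)%:E + mu (S @^-1` Y))%E.
  have mUY : measurable (U `\` Y) by exact: measurableD.
  apply: le_trans (measure_subU _ _ _ _ (measurable_preimage _ mUY) (measurable_preimage _ mY) _) _.
  - exact: measurable_preimage.
  - by move=> x Ux; have [Yx|nYx] := pselect (Y (S x)); [by right|by left].
  (* Absolute continuity would not do here, since the preimage is not cut down to a set of finite
     measure; the inequality already proved bounds all of S^-1 (U \ Y). *)
  - apply: leeD => //; apply: le_trans (commuting_le _ mUY _) _.
      by apply: lt_trans UY' _; rewrite ltry.
    by apply: le_trans (ltW UY') _; rewrite lee_fin ge_min lexx.
have YU' : (mu (Y `\` U) <= (e / 4)%:E)%E.
  by apply: le_trans (ltW YU) _; rewrite lee_fin ge_min lexx.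
have mSZ := measurable_preimage _ mZk.
have mSZW := measurable_preimage _ mZW.
have mSW := measurable_preimage _ mW.
have step1 : (mu Y <= mu (Y `\` U) + mu (Y `&` U))%E.
  apply: measure_subU => //; [exact: measurableD|exact: measurableI|].
  by move=> x Yx; have [Ux|nUx] := pselect (U x); [by right|by left].
have step2 : (mu (Y `&` U) <= mu (Y `\` S @^-1` (Z k)) + mu (S @^-1` (Z k) `&` (Y `&` U)))%E.
  apply: measure_subU; do ?[exact: measurableI|exact: measurableD].
    by apply: measurableI => //; exact: measurableI.
  by move=> x [Yx Ux]; have [Zx|nZx] := pselect (Z k (S x)); [by right|by left].
have step3 : (mu (S @^-1` (Z k) `&` (Y `&` U)) <=
    mu (S @^-1` (Z k `\` W) `&` Y) + mu (U `&` S @^-1` W))%E.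
  apply: measure_subU; do ?[exact: measurableI|exact: measurableD].
    by apply: measurableI => //; exact: measurableI.
  by move=> x [Zx [Yx Ux]]; have [Wx|nWx] := pselect (W (S x)); [by right|by left].
apply: le_trans step1 _; rewrite !EFinD.
rewrite [leRHS]addeC -!addeA.
apply: leeD => //; apply: le_trans step2 _; apply: leeD; first exact: ltW.
apply: le_trans step3 _; apply: leeD => //.
exact: le_trans H1 small3.
Qed.

End NonSquashable.

Lemma rank_one_non_squashable {d} {X : measurableType d} {R : realType}
    (mu : {measure set X -> \bar R}) (T : int -> X -> X) :
  sigma_finite setT mu -> mp_action mu T -> rank_one mu T -> non_squashable mu T.
Proof.
move=> sfX actT r1T S nsS STae A mA.
have mSA B : measurable B -> measurable (S @^-1` B).
  by move=> mB; rewrite -[_ @^-1` _]setTI; have [mS _] := nsS; exact: mS.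
have fin B : measurable B -> (mu B < +oo)%E -> mu (S @^-1` B) = mu B.
  move=> mB Boo; apply/eqP; rewrite eq_le.
  by rewrite (commuting_le _ _ actT) ?(commuting_ge _ _ actT).
have /sigma_finiteP[Z [ZT ndZ mZ]] := sfX.
have AZE k : mu (S @^-1` (A `&` Z k)) = mu (A `&` Z k).
  have [mZk Zkoo] := mZ k; apply: fin; first exact: measurableI.
  by apply: le_lt_trans Zkoo; apply: le_measure; rewrite ?inE//; exact: measurableI.
apply/eqP; rewrite eq_le; apply/andP; split.
(* Exhausting by preimages turns each piece into S^-1 (A /\ Z_k), to which the case of finite
   measure applies. *)
- apply: (measure_le_exhaustion mu (fun k => S @^-1` (Z k))) => //.
  + by move=> k; apply: mSA; have [] := mZ k.
  + by move=> n m nm; rewrite subsetEset; apply: preimage_subset;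
      rewrite -subsetEset; exact: ndZ.
  + by rewrite -preimage_bigcup -ZT preimage_setT.
  + exact: mSA.
  + move=> k; have [mZk Zkoo] := mZ k; rewrite -preimage_setI AZE.
    by apply: le_measure; rewrite ?inE//; exact: measurableI.
- apply: (measure_le_exhaustion mu Z) => // k; first by have [] := mZ k.
  have [mZk Zkoo] := mZ k; rewrite -AZE.
  apply: le_measure; rewrite ?inE; do ?[exact: mSA|apply: mSA; exact: measurableI].
  by move=> x [].
Qed.


(** * Weak rational ergodicity *)

Section FiniteUnion.
Context {d : measure_display} {X : measurableType d} {R : realType}.
Variable mu : {measure set X -> \bar R}.

Lemma fine_measure_setI_bigcup (A : set X) (h : nat) (F : pred nat) (E : nat -> set X) :
  measurable A -> (mu A < +oo)%E -> (forall j, measurable (E j)) ->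
  trivIset `I_h E ->
  fine (mu (A `&` \bigcup_(j in [set j | (j < h)%N && F j]) E j)) =
  \sum_(0 <= j < h | F j) fine (mu (A `&` E j)).
Proof.
move=> mA Aoo mE tE.
have mUn n : measurable (\bigcup_(j in [set j | (j < n)%N && F j]) E j).
  by apply: bigcup_measurable => j _; exact: mE.
have finI B : measurable B -> mu (A `&` B) \is a fin_num.
  move=> mB; rewrite ge0_fin_numE//; apply: le_lt_trans Aoo.
  by apply: le_measure; rewrite ?inE//; exact: measurableI.
suff H n : (n <= h)%N ->
    fine (mu (A `&` \bigcup_(j in [set j | (j < n)%N && F j]) E j)) =
    \sum_(0 <= j < n | F j) fine (mu (A `&` E j)) by exact: H.
elim: n => [_|n IH nh].
  rewrite big_nil (_ : A `&` _ = set0) ?measure0//.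
  by rewrite -subset0 => x [_ [j]].
rewrite big_mkcond big_nat_recr//= -big_mkcond/= -IH; last exact: ltnW.
case: ifPn => Fn; last first.
  rewrite addr0; congr (fine (mu (_ `&` _))); apply/seteqP; split => x [j /= /andP[jn Fj] Ex].
    exists j => //=; rewrite Fj andbT ltn_neqAle -ltnS jn andbT.
    by apply: contraNneq Fn => <-.
  by exists j => //=; rewrite Fj andbT ltnW.
rewrite -fineD ?finI// -measureU; last 3 first.
- exact: measurableI.
- exact: measurableI.
- rewrite -subset0 => x [[_ [j /= /andP[jn _] Ejx]] [_ Enx]].
  move/trivIsetP: tE => /(_ j n) /=; rewrite (ltn_trans jn)// nh => /(_ isT isT).
  by rewrite (ltn_eqF jn) => /(_ isT) jn0; rewrite -[False]/(set0 x) -jn0; split.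
congr (fine (mu _)); rewrite -setIUr; congr (_ `&` _).
apply/seteqP; split => x.
  move=> [j /= /andP[jn Fj] Ex]; move: jn; rewrite ltnS leq_eqVlt => /orP[/eqP jn|jn].
    by right; rewrite -jn.
  by left; exists j => //=; rewrite jn.
move=> [[j /= /andP[jn Fj] Ex]|Ex]; last by exists n => //=; rewrite ltnSn.
by exists j => //=; rewrite Fj andbT ltnW.
Qed.

End FiniteUnion.

Section Telescope.
Context {R : realType}.

(** Moving the window by one step gains one term and loses one; both lie in [0, 1], so each step
    costs at most 1, whatever L is. *)
Lemma sum_shift_le (r : int -> R) (L t : nat) : (forall z, 0 <= r z <= 1) ->
  `|\sum_(0 <= k < L) r (k%:Z + t%:Z) - \sum_(0 <= k < L) r k%:Z| <= t%:R.
Proof.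
move=> r01; elim: t => [|t IH].
  by rewrite (eq_bigr (fun k : nat => r k%:Z)) ?subrr ?normr0// => k _; rewrite addr0.
have E : \sum_(0 <= k < L) r (k%:Z + t.+1%:Z) - \sum_(0 <= k < L) r (k%:Z + t%:Z) =
    r (L%:Z + t%:Z) - r (0%:Z + t%:Z).
  rewrite -sumrB -(telescope_sumr (fun k : nat => r (k%:Z + t%:Z)))//.
  by apply: eq_bigr => k _; congr (r _ - _); lia.
rewrite -(subrKA (\sum_(0 <= k < L) r (k%:Z + t%:Z))) E.
apply: le_trans (ler_normD _ _) _; rewrite -natr1 addrC; apply: lerD => //.
by have := r01 (L%:Z + t%:Z); have := r01 (0%:Z + t%:Z); rewrite ler_norml; lra.
Qed.

Lemma sum_shiftz_le (r : int -> R) (L : nat) (t : int) : (forall z, 0 <= r z <= 1) ->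
  `|\sum_(0 <= k < L) r (k%:Z + t) - \sum_(0 <= k < L) r k%:Z| <= `|t|%N%:R.
Proof.
move=> r01; case: t => t; first exact: sum_shift_le.
(* A shift to the left is a shift to the right of the function translated beforehand. *)
have := sum_shift_le (fun z => r (z - t.+1%:Z)) L t.+1 (fun z => r01 _).
rewrite distrC NegzE abszN /=; congr (`|_ - _| <= _).
  by apply: eq_bigr => k _; congr r; lia.
Qed.

End Telescope.

(** * A set of measure one that is a union of levels of every tower *)

Section CutAndStack.
Context {d : measure_display} {X : measurableType d} {R : realType}.
Variables (mu : {measure set X -> \bar R}) (T : int -> X -> X).
Hypothesis actT : mp_action mu T.
Variables (Y : set X) (P : nat -> set X) (h : nat -> nat) (D : nat -> pred nat).

(** [F] selects levels of the n-th tower, and [D n] the levels making up [Y]. For the (C,F)-action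
    [D n] is C_1 + ... + C_n. *)
Let U n (F : pred nat) :=
  \bigcup_(j in [set j | (j < h n)%N && F j]) (T j%:Z @` P n).
Let N n := \sum_(0 <= j < h n | D n j) 1%N.

Hypotheses (muY : mu Y = 1%E) (mP : forall n, measurable (P n))
  (tP : forall n, is_tower T (h n) (P n)) (YE : forall n, Y = U n (D n))
  (P0 : fine (mu (P n)) @[n --> \oo] --> (0 : R))
  (approx : forall A (e : R), measurable A -> A `<=` Y -> 0 < e ->
    \forall n \near \oo, exists2 F : pred nat, {subset F <= D n} & (mu (A `+` U n F) < e%:E)%E).

Let mTP n j : measurable (T j @` P n).
Proof. exact: (measurable_act_image _ _ actT). Qed.

Let mU n F : measurable (U n F).
Proof. by apply: bigcup_measurable => j _; exact: mTP. Qed.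

Let mY : measurable Y. Proof. by rewrite (YE 0). Qed.

Let finY A : measurable A -> A `<=` Y -> (mu A < +oo)%E.
Proof.
move=> mA AY; apply: (@le_lt_trans _ _ (mu Y)); last by rewrite muY ltry.
by apply: le_measure; rewrite ?inE.
Qed.

Let U_sub n F : {subset F <= D n} -> U n F `<=` Y.
Proof.
move=> FD; rewrite (YE n); apply: bigcup_subset => j /= /andP[-> Fj].
exact: FD.
Qed.

Let fine_measure_le A B : measurable A -> measurable B -> (mu B < +oo)%E -> A `<=` B ->
  fine (mu A) <= fine (mu B).
Proof.
move=> mA mB Boo AB; have AB' : (mu A <= mu B)%E by apply: le_measure; rewrite ?inE.
by apply: fine_le => //; rewrite ge0_fin_numE//; exact: le_lt_trans Boo.
Qed.

Let c (k : int) (A B : set X) := fine (mu (A `&` T k @` B)).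

Let c_opp k A B : measurable A -> measurable B -> c k A B = fine (mu (B `&` T (- k) @` A)).
Proof.
move=> mA mB; rewrite /c -(measure_act_image _ _ actT (- k)); last first.
  by apply: measurableI => //; exact: (measurable_act_image _ _ actT).
by rewrite (act_imageI _ _ actT) (act_image_comp _ _ actT) addNr (act_image0 _ _ actT) setIC.
Qed.

Let c_fin A B k : measurable A -> A `<=` Y -> measurable B -> (mu (A `&` T k @` B) < +oo)%E.
Proof.
move=> mA AY mB; apply: le_lt_trans (finY _ mA AY).
apply: le_measure; rewrite ?inE//; apply: measurableI => //.
exact: (measurable_act_image _ _ actT).
Qed.

Let c_ge0 k A B : 0 <= c k A B. Proof. exact/fine_ge0. Qed.

Let cUr k A n F : measurable A -> A `<=` Y ->
  c k A (U n F) = \sum_(0 <= j < h n | F j) c k A (T j%:Z @` P n).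
Proof.
move=> mA AY; rewrite /c image_bigcup fine_measure_setI_bigcup//.
- exact: finY.
- by move=> j; rewrite (act_image_comp _ _ actT).
- move: (is_tower_shift _ _ actT (h n) _ k (tP n)); rewrite /is_tower.
  congr (trivIset _ _); apply/funext => g.
  by rewrite !(act_image_comp _ _ actT) addrC.
Qed.

Let cYr k A n : measurable A -> A `<=` Y ->
  c k A Y = \sum_(0 <= j < h n | D n j) c k A (T j%:Z @` P n).
Proof. by move=> mA AY; rewrite -cUr// -YE. Qed.

Let cUl k B n F : measurable B -> B `<=` Y ->
  c k (U n F) B = \sum_(0 <= j < h n | F j) c k (T j%:Z @` P n) B.
Proof.
move=> mB BY; rewrite c_opp// -[fine _]/(c (- k) B (U n F)) cUr//.
by apply: eq_bigr => j _; rewrite [RHS]c_opp.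
Qed.

Let N_gt0 n : (0 < N n)%N.
Proof.
rewrite lt0n; apply: contra_eq_neq muY => N0.
rewrite (YE n) (_ : U n (D n) = set0) ?measure0; first by rewrite eqe eq_sym oner_eq0.
rewrite -subset0 => x [j /= /andP[jh Dj] _].
suff : (0 < N n)%N by rewrite N0.
by rewrite /N big_mkord (bigD1 (Ordinal jh)).
Qed.

Let mU_fine n F : {subset F <= D n} ->
  fine (mu (U n F)) = (\sum_(0 <= j < h n | F j) 1%N)%:R * fine (mu (P n)).
Proof.
move=> FD; have := cUr 0 Y n F mY (fun x Yx => Yx).
rewrite /c (act_image0 _ _ actT) setIidr; last exact: U_sub.
move=> ->; rewrite natr_sum mulr_suml !big_mkord; apply: eq_bigr => j Fj.
rewrite mul1r (act_image0 _ _ actT) setIidr ?(measure_act_image _ _ actT)//.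
by rewrite (YE n) => x Px; exists (j : nat) => //=; rewrite ltn_ord; exact: FD.
Qed.

Let NP n : (N n)%:R * fine (mu (P n)) = 1.
Proof. by rewrite -mU_fine// -YE muY. Qed.

Let Noo : (N n)%:R @[n --> \oo] --> (+oo : set_system R).
Proof.
apply/gtr0_cvgV0; first by apply: nearW => n; rewrite ltr0n.
have E : (fun n => fine (mu (P n))) = (fun n : nat => ((N n)%:R : R)^-1).
  apply/funext => n; apply/esym.
  have N0 : (N n)%:R != 0 :> R by rewrite pnatr_eq0 -lt0n.
  by apply: (mulfI N0); rewrite NP divff.
by move: P0; rewrite E.
Qed.

Let muP_ge0 n : 0 <= fine (mu (P n)). Proof. exact/fine_ge0. Qed.

Local Notation corr := (corr_sum mu T).

Let corrE L A B : corr L A B = \sum_(0 <= k < L) c k%:Z A B.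
Proof. by []. Qed.

(** A point T_k z of A with z in B is counted on the right by the first sum unless it lies outside
    A' or z lies outside B'. Exchanging primed and unprimed sets gives the reverse estimate. *)
Let corr_leY L A A' B B' : measurable A -> measurable B -> measurable A' -> measurable B' ->
  A `<=` Y -> B `<=` Y -> A' `<=` Y -> B' `<=` Y ->
  corr L A B <= corr L A' B' + corr L (A `\` A') Y + corr L Y (B `\` B').
Proof.
move=> mA mB mA' mB' AY BY AY' BY'; rewrite !corrE -!big_split; apply: ler_sum => k _ /=.
have mT C := measurable_act_image _ _ actT k C.
have AAY : A `\` A' `<=` Y by move=> x [/AY].
have BBY : B `\` B' `<=` Y by move=> x [/BY].
have mAA := measurableD mA mA'; have mBB := measurableD mB mB'.
have fn C E : measurable C -> C `<=` Y -> measurable E -> mu (C `&` T k @` E) \is a fin_num.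
  by move=> mC CY mE; rewrite ge0_fin_numE//; exact: c_fin.
rewrite -lee_fin !EFinD !fineK ?fn//.
apply: le_trans (leeD (measureU2 mu _ _) (lexx _));
  do ?[by apply: measurableI => //; exact: mT].
apply: le_trans (measureU2 mu _ _);
  do ?[apply: measurableU|by apply: measurableI => //; exact: mT].
apply: le_measure; rewrite ?inE;
  do ?[apply: measurableU|by apply: measurableI => //; exact: mT].
move=> x [Ax [z Bz zx]]; have [A'x|nA'x] := pselect (A' x); last first.
  by left; right; split => //; exists z => //; exact: BY.
have [B'z|nB'z] := pselect (B' z); last by right; split; [exact: AY|exists z].
by left; left; split => //; exists z.
Qed.

Let corr_le_left n A : measurable A -> A `<=` Y ->
  corr (h n) A Y <= (N n)%:R * fine (mu A).
Proof.
move=> mA AY; rewrite corrE (eq_bigr _ (fun k _ => cYr k%:Z A n mA AY)).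
rewrite exchange_big/= natr_sum mulr_suml; apply: ler_sum => j _; rewrite mul1r.
have mE k : measurable (T k%:Z @` (T j%:Z @` P n)) by exact: (measurable_act_image _ _ actT).
rewrite -(fine_measure_setI_bigcup mu A (h n) xpredT _ mA (finY _ mA AY) mE); last first.
  exact: (is_tower_shift _ _ actT).
apply: fine_measure_le => //; [|exact: finY].
by apply: measurableI => //; exact: bigcup_measurable.
Qed.

Let corr_le_right n B : measurable B -> B `<=` Y ->
  corr (h n) Y B <= (N n)%:R * fine (mu B).
Proof.
move=> mB BY; rewrite corrE; under eq_bigr do rewrite c_opp//.
rewrite (eq_bigr _ (fun k _ => cYr (- k%:Z) B n mB BY)).
rewrite exchange_big/= natr_sum mulr_suml; apply: ler_sum => j _; rewrite mul1r.
have mE k : measurable (T (- k%:Z) @` (T j%:Z @` P n)).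
  exact: (measurable_act_image _ _ actT).
rewrite -(fine_measure_setI_bigcup mu B (h n) xpredT _ mB (finY _ mB BY) mE); last first.
  by apply: (is_tower_opp _ _ actT); exact: (is_tower_shift _ _ actT).
apply: fine_measure_le => //; [|exact: finY].
by apply: measurableI => //; exact: bigcup_measurable.
Qed.

(** The sum and its transpose together count each pair at least once, as j <= i or i <= j. *)
Let pairs_ge n : (N n * N n <=
  2 * \sum_(0 <= j < h n | D n j) \sum_(0 <= i < h n | D n i) (j <= i)%N)%N.
Proof.
rewrite mul2n -addnn {2}exchange_big/= -big_split/= /N big_distrl/=.
apply: leq_sum => j _; rewrite mul1n -big_split; apply: leq_sum => i _ /=.
by case: (leqP j i) => //= /ltnW ->.
Qed.

(** If levels j <= i both lie in Y, time k = i - j carries level j onto level i and contributes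
    mu(P_n) = 1 / N_n. There are at least N_n^2 / 2 such pairs. *)
Let corr_ge n : (N n)%:R / 2 <= corr (h n) Y Y.
Proof.
have step j : (j < h n)%N -> D n j ->
    \sum_(0 <= i < h n | D n i) (j <= i)%N%:R * fine (mu (P n)) <=
    \sum_(0 <= k < h n) c k%:Z Y (T j%:Z @` P n).
  move=> jh Dj.
  rewrite (@big_cat_nat _ _ _ j)//=; last exact: ltnW.
  rewrite big_nat_cond big1 ?add0r; last first.
    by move=> i /andP[/andP[_ ij] _]; rewrite leqNgt ij mul0r.
  (* Reindexing by k = i - j; times k >= h n - j, which would leave the tower, are dropped. *)
  rewrite -{1}(add0n j) big_addn.
  apply: (@le_trans _ _ (\sum_(0 <= k < h n - j) c k%:Z Y (T j%:Z @` P n))); last first.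
    rewrite [leRHS](@big_cat_nat _ _ _ (h n - j))//=; last exact: leq_subr.
    by rewrite lerDl sumr_ge0.
  rewrite big_mkcond /= big_nat_cond [leRHS]big_nat_cond.
  apply: ler_sum => k /andP[/andP[_ kh] _].
  case: ifPn => // Dk; rewrite leq_addl mul1r /c (act_image_comp _ _ actT) setIidr.
    by rewrite (measure_act_image _ _ actT).
  by rewrite (YE n) => x Px; exists (k + j)%N => //=; rewrite Dk andbT addnC -ltn_subRL.
have -> : corr (h n) Y Y =
    \sum_(0 <= j < h n | D n j) \sum_(0 <= k < h n) c k%:Z Y (T j%:Z @` P n).
  rewrite exchange_big/= corrE; apply: eq_bigr => k _.
  by rewrite -cYr.
apply: (@le_trans _ _ (\sum_(0 <= j < h n | D n j)
    \sum_(0 <= i < h n | D n i) (j <= i)%N%:R * fine (mu (P n)))); last first.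
  rewrite big_nat_cond [leRHS]big_nat_cond; apply: ler_sum => j /andP[/andP[_ jh] Dj].
  exact: step.
under eq_bigr do rewrite -mulr_suml -natr_sum.
rewrite -mulr_suml -natr_sum.
have := pairs_ge n; rewrite -(ler_nat R) !natrM => H.
have := ler_wpM2r (muP_ge0 n) H.
by rewrite -(mulrA (N n)%:R) NP mulr1; lra.
Qed.

(* T_i P /\ T_k T_j P is a translate of P /\ T_(k + j - i) P, so the sums over a window
   of two pairs of levels differ at most by the shift of the window. *)
Let corr_UU_shift n L F G : {subset F <= D n} -> {subset G <= D n} ->
  `|corr L (U n F) (U n G) - (\sum_(0 <= j < h n | F j) 1%N)%:R *
     (\sum_(0 <= j < h n | G j) 1%N)%:R * corr L (P n) (P n)| <= (h n)%:R ^+ 3.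
Proof.
move=> FD GD.
have P1 : fine (mu (P n)) <= 1.
  rewrite -(NP n) ler_peMl// -[1]/(1%:R) ler_nat; exact: N_gt0.
(* [fine] would send an infinite measure to 0, contradicting [NP]. *)
have Poo : (mu (P n) < +oo)%E.
  rewrite ltNge leye_eq; apply/eqP => Pinf.
  by have := NP n; rewrite Pinf mulr0 => /eqP; rewrite eq_sym oner_eq0.
have r01 z : 0 <= c z (P n) (P n) <= 1.
  rewrite c_ge0 /=; apply: le_trans P1; apply: fine_measure_le => //.
  by apply: measurableI => //; exact: (measurable_act_image _ _ actT).
have sF H : ((\sum_(0 <= j < h n | H j) 1)%N <= h n)%N.
  apply: (@leq_trans (\sum_(0 <= j < h n) 1)%N).
    by rewrite big_mkcond; apply: leq_sum => i _; case: ifP.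
  by rewrite sum_nat_const_nat subn0 muln1.
have shift (k : nat) i j :
    c k%:Z (T i%:Z @` P n) (T j%:Z @` P n) = c (k%:Z + (j%:Z - i%:Z)) (P n) (P n).
  rewrite /c (_ : _ `&` _ = T i%:Z @` (P n `&` T (k%:Z + (j%:Z - i%:Z)) @` P n)).
    rewrite (measure_act_image _ _ actT)//.
    by apply: measurableI => //; exact: (measurable_act_image _ _ actT).
  by rewrite (act_imageI _ _ actT) !(act_image_comp _ _ actT); congr (_ `&` T _ @` _); lia.
have -> : corr L (U n F) (U n G) = \sum_(0 <= i < h n | F i) \sum_(0 <= j < h n | G j)
    \sum_(0 <= k < L) c (k%:Z + (j%:Z - i%:Z)) (P n) (P n).
  rewrite corrE; under eq_bigr do rewrite (cUl _ _ n F (mU n G) (U_sub n G GD)).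
  rewrite exchange_big/=; rewrite big_nat_cond [RHS]big_nat_cond.
  apply: eq_bigr => i /andP[/andP[_ ih] Fi].
  have TiY : T i%:Z @` P n `<=` Y.
    by rewrite (YE n) => x Px; exists i => //=; rewrite ih /=; exact: FD.
  under eq_bigr do rewrite (cUr _ _ n G (mTP n i%:Z) TiY).
  rewrite exchange_big/=; apply: eq_bigr => j _.
  by apply: eq_bigr => k _; rewrite shift.
set s := corr L (P n) (P n).
have sE : s = \sum_(0 <= k < L) c k%:Z (P n) (P n) by [].
have -> : (\sum_(0 <= j < h n | F j) 1%N)%:R * (\sum_(0 <= j < h n | G j) 1%N)%:R * s =
    \sum_(0 <= i < h n | F i) \sum_(0 <= j < h n | G j) s.
  rewrite !natr_sum mulr_suml mulr_suml; apply: eq_bigr => i _; rewrite mul1r mulr_suml.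
  by apply: eq_bigr => j _; rewrite mul1r.
rewrite -sumrB; apply: le_trans (ler_norm_sum _ _ _) _.
apply: (@le_trans _ _ (\sum_(0 <= i < h n | F i) \sum_(0 <= j < h n | G j) (h n)%:R)).
  rewrite big_nat_cond [leRHS]big_nat_cond; apply: ler_sum => i /andP[/andP[_ ih] _].
  rewrite -sumrB; apply: le_trans (ler_norm_sum _ _ _) _.
  rewrite big_nat_cond [leRHS]big_nat_cond; apply: ler_sum => j /andP[/andP[_ jh] _].
  have := sum_shiftz_le (fun z => c z (P n) (P n)) L (j%:Z - i%:Z) r01.
  by move=> /le_trans; apply; rewrite ler_nat; lia.
have -> : \sum_(0 <= i < h n | F i) \sum_(0 <= j < h n | G j) (h n)%:R =
    (\sum_(0 <= j < h n | F j) 1%N)%:R * (\sum_(0 <= j < h n | G j) 1%N)%:R * (h n)%:R :> R.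
  rewrite !natr_sum mulr_suml mulr_suml; apply: eq_bigr => i _; rewrite mul1r mulr_suml.
  by apply: eq_bigr => j _; rewrite mul1r.
by rewrite -!natrM -natrX ler_nat expnS expnS expn1 mulnA leq_mul// leq_mul.
Qed.

Let corr_oo : corr (h l) Y Y @[l --> \oo] --> (+oo : set_system R).
Proof.
apply/cvgryPge => A; near=> l; apply: le_trans (corr_ge l).
rewrite ler_pdivlMr//; near: l.
by move/cvgryPge: Noo => /(_ (A * 2)).
Unshelve. all: by end_near. Qed.

Let corr_gt0 l : 0 < corr (h l) Y Y.
Proof. by apply: lt_le_trans (corr_ge l); rewrite divr_gt0// ltr0n. Qed.

(** The sum over P_n is eliminated by comparing the estimate for F, G with the one for the whole of
    Y. As N_n mu(P_n) = 1, the second is rescaled by mu(U_F) mu(U_G) <= 1, so each costs at most (h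
    n)^3, independently of L. *)
Let corr_UU n F G : {subset F <= D n} -> {subset G <= D n} -> forall L,
  `|corr L (U n F) (U n G) - fine (mu (U n F)) * fine (mu (U n G)) * corr L Y Y|
    <= 2 * (h n)%:R ^+ 3.
Proof.
move=> FD GD L; rewrite !mU_fine//.
have HFG := corr_UU_shift n L _ _ FD GD.
have := corr_UU_shift n L (D n) (D n) (fun x => id) (fun x => id).
rewrite -YE -/(N n) => HY.
set f := (\sum_(0 <= j < h n | F j) 1)%N%:R in HFG *.
set g := (\sum_(0 <= j < h n | G j) 1)%N%:R in HFG *.
set p := fine (mu (P n)); set s := corr L (P n) (P n) in HFG HY *.
set y := corr L Y Y in HY *; set K := (h n)%:R ^+ 3 in HFG HY *.
have leN H : {subset H <= D n} -> ((\sum_(0 <= j < h n | H j) 1)%N <= N n)%N.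
  move=> HD; rewrite /N big_mkcond [leqRHS]big_mkcond; apply: leq_sum => j _.
  by case: ifPn => // /HD Dj; rewrite [D n j]Dj.
have fp0 : 0 <= f * p by rewrite mulr_ge0// muP_ge0.
have gp0 : 0 <= g * p by rewrite mulr_ge0// muP_ge0.
have fp1 : f * p <= 1 by rewrite -(NP n) ler_wpM2r// ?muP_ge0// ler_nat leN.
have gp1 : g * p <= 1 by rewrite -(NP n) ler_wpM2r// ?muP_ge0// ler_nat leN.
have fg01 : 0 <= f * p * (g * p) <= 1 by rewrite mulr_ge0//= mulr_ile1.
have E : f * p * (g * p) * ((N n)%:R * (N n)%:R * s) = f * g * s.
  transitivity (f * g * s * ((N n)%:R * p) ^+ 2); first by ring.
  by rewrite NP expr1n mulr1.
set a := corr L (U n F) (U n G) in HFG *.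
have -> : a - f * p * (g * p) * y =
    (a - f * g * s) - f * p * (g * p) * (y - (N n)%:R * (N n)%:R * s).
  by rewrite mulrBr E; ring.
apply: le_trans (ler_normB _ _) _; rewrite (_ : 2 * K = K + K); last by ring.
apply: lerD => //.
have [fg0 fg1] := andP fg01.
by rewrite normrM (ger0_norm fg0); apply: le_trans HY; rewrite ler_piMl.
Qed.

Theorem cut_and_stack_ratio A B : measurable A -> measurable B -> A `<=` Y -> B `<=` Y ->
  corr (h l) A B / corr (h l) Y Y @[l --> \oo] --> fine (mu A) * fine (mu B).
Proof.
move=> mA mB AY BY; apply/cvgrPdist_le => e e0.
(* As N_l <= 2 C, a set of measure at most [dlt] has correlation sum at most (e / 8) C with Y, and
   replacing both measures in the product costs 2 dlt = e / 8. Two error sets, the shift error and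
   the product then stay within e / 2. *)
pose dlt := e / 16.
have dlt0 : 0 < dlt by rewrite divr_gt0.
have [n [[F FD AF] [G GD BG]]] : exists n,
    (exists2 F : pred nat, {subset F <= D n} & (mu (A `+` U n F) < dlt%:E)%E) /\
    (exists2 F : pred nat, {subset F <= D n} & (mu (B `+` U n F) < dlt%:E)%E).
  by apply: (@filter_ex _ \oo); apply: filterI; exact: approx.
have FY := U_sub _ _ FD; have GY := U_sub _ _ GD.
have finD C E : measurable C -> measurable E -> C `<=` Y -> E `<=` Y ->
    (mu (C `+` E) < dlt%:E)%E ->
    [/\ fine (mu (C `\` E)) <= dlt, fine (mu (E `\` C)) <= dlt &
      fine (mu C) - fine (mu E) = fine (mu (C `\` E)) - fine (mu (E `\` C))].
  move=> mC mE CY EY; rewrite setY_def => CE.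
  have mCE := measurableD mC mE; have mEC := measurableD mE mC.
  have CEY : C `\` E `<=` Y by move=> x [/CY].
  have ECY : E `\` C `<=` Y by move=> x [/EY].
  have fn Z : measurable Z -> Z `<=` Y -> mu Z \is a fin_num.
    by move=> mZ ZY; rewrite ge0_fin_numE//; exact: finY.
  split.
  - rewrite -lee_fin fineK ?fn//; apply: le_trans (ltW CE).
    by apply: le_measure; rewrite ?inE//; exact: measurableU.
  - rewrite -lee_fin fineK ?fn//; apply: le_trans (ltW CE).
    by apply: le_measure; rewrite ?inE//; exact: measurableU.
  - rewrite (measureDI mu mC mE) (measureDI mu mE mC) (setIC E C).
    have CIY : C `&` E `<=` Y by move=> x [/CY].
    have fCI := fn _ (measurableI _ _ mC mE) CIY.
    by rewrite !fineD ?(fn _ mCE CEY) ?(fn _ mEC ECY)//; ring.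
have [AF1 AF2 AF3] := finD _ _ mA (mU n F) AY FY AF.
have [BG1 BG2 BG3] := finD _ _ mB (mU n G) BY GY BG.
(* The stage n and the selections F, G are fixed before l, so the shift error 2 (h n)^3 is a
   constant absorbed by the divergence of C. *)
near=> l.
set C := corr (h l) Y Y.
have C0 : 0 < C by exact: corr_gt0.
have K : 2 * (h n)%:R ^+ 3 <= e / 8 * C.
  rewrite [leRHS]mulrC -ler_pdivrMr ?divr_gt0// /C; near: l.
  by move/cvgryPge: corr_oo; apply.
have NC : (N l)%:R <= 2 * C by have := corr_ge l; rewrite -/C; lra.
have small E : measurable E -> E `<=` Y -> fine (mu E) <= dlt ->
    corr (h l) E Y <= e / 8 * C /\ corr (h l) Y E <= e / 8 * C.
  move=> mE EY Ed.
  have : (N l)%:R * fine (mu E) <= e / 8 * C.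
    apply: (@le_trans _ _ (2 * C * dlt)); last by rewrite /dlt; lra.
    by apply: ler_pM => //; exact/fine_ge0.
  move=> NE; split; apply: le_trans NE; [exact: corr_le_left|exact: corr_le_right].
have smallA : corr (h l) (A `\` U n F) Y <= e / 8 * C.
  by have [] := small (A `\` U n F) (measurableD mA (mU n F)) (fun x Ax => AY _ (proj1 Ax)) AF1.
have smallF : corr (h l) (U n F `\` A) Y <= e / 8 * C.
  by have [] := small (U n F `\` A) (measurableD (mU n F) mA) (fun x Ax => FY _ (proj1 Ax)) AF2.
have smallB : corr (h l) Y (B `\` U n G) <= e / 8 * C.
  by have [] := small (B `\` U n G) (measurableD mB (mU n G)) (fun x Ax => BY _ (proj1 Ax)) BG1.
have smallG : corr (h l) Y (U n G `\` B) <= e / 8 * C.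
  by have [] := small (U n G `\` B) (measurableD (mU n G) mB) (fun x Ax => GY _ (proj1 Ax)) BG2.
have le1 E : measurable E -> E `<=` Y -> fine (mu E) <= 1.
  move=> mE EY; rewrite -[leRHS]/(fine (1%E : \bar R)) -muY.
  by apply: fine_measure_le => //; exact: finY.
have H1 := corr_leY (h l) _ _ _ _ mA mB (mU n F) (mU n G) AY BY FY GY.
have H2 := corr_leY (h l) _ _ _ _ (mU n F) (mU n G) mA mB FY GY AY BY.
have := corr_UU n F G FD GD (h l); rewrite -/C ler_norml => /andP[H3 H4].
have a1 := le1 _ mA AY; have v1 := le1 _ (mU n G) GY.
have a0 : 0 <= fine (mu A) by exact/fine_ge0.
have v0 : 0 <= fine (mu (U n G)) by exact/fine_ge0.
have AF0 : 0 <= fine (mu (A `\` U n F)) by exact/fine_ge0.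
have FA0 : 0 <= fine (mu (U n F `\` A)) by exact/fine_ge0.
have BG0 : 0 <= fine (mu (B `\` U n G)) by exact/fine_ge0.
have GB0 : 0 <= fine (mu (U n G `\` B)) by exact/fine_ge0.
have prod : `|fine (mu A) * fine (mu B) - fine (mu (U n F)) * fine (mu (U n G))| <= e / 8.
  have -> : fine (mu A) * fine (mu B) - fine (mu (U n F)) * fine (mu (U n G)) =
     fine (mu A) * (fine (mu B) - fine (mu (U n G))) +
     (fine (mu A) - fine (mu (U n F))) * fine (mu (U n G)) by ring.
  have bnd x y : 0 <= x <= 1 -> `|y| <= dlt -> `|x * y| <= dlt.
    move=> /andP[x0 x1] yd; rewrite normrM ger0_norm//.
    by apply: le_trans yd; rewrite ler_piMl.
  apply: le_trans (ler_normD _ _) _.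
  have -> : e / 8 = dlt + dlt by rewrite /dlt; lra.
  apply: lerD; [apply: bnd|rewrite mulrC; apply: bnd]; rewrite ?a0 ?v0//.
    by rewrite BG3 ler_norml; lra.
  by rewrite AF3 ler_norml; lra.
rewrite -(@ler_pM2r _ C)// -[X in _ * X <= _](gtr0_norm C0) -normrM mulrBl divfK ?gt_eqF//.
move: prod; rewrite ler_norml => /andP[p1 p2].
have p1' := ler_wpM2r (ltW C0) p1; have p2' := ler_wpM2r (ltW C0) p2.
rewrite mulrBl in p1' p2'.
by rewrite ler_norml; apply/andP; split; lra.
Unshelve. all: by end_near. Qed.

(** Bounded sums divided by a divergent denominator tend to 0, while the ratio tends to mu(A) mu(B).
    Both conservativity and ergodicity are read off from this. *)
Let ratio_unique A B (a : R) : measurable A -> measurable B -> A `<=` Y -> B `<=` Y ->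
  (forall l, 0 <= corr (h l) A B <= a) -> fine (mu A) * fine (mu B) = 0.
Proof.
move=> mA mB AY BY AB.
have CV : (corr (h l) Y Y)^-1 @[l --> \oo] --> (0 : R).
  by apply/gtr0_cvgV0; [exact: nearW|exact: corr_oo].
have H0 : corr (h l) A B / corr (h l) Y Y @[l --> \oo] --> (0 : R).
  apply: (@squeeze_cvgr _ _ _ _ (fun=> 0) (fun l => a * (corr (h l) Y Y)^-1)).
  - apply: nearW => l; have /andP[ABl ABu] := AB l.
    rewrite mulr_ge0 ?invr_ge0 ?(ltW (corr_gt0 l))//=.
    by rewrite ler_wpM2r// invr_ge0 ltW.
  - exact: cvg_cst.
  - by rewrite -[X in _ --> X](mulr0 a); apply: cvgMr; exact: CV.
exact: cvg_unique (cut_and_stack_ratio A B mA mB AY BY) H0.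
Qed.

Hypothesis coverY : mu (~` \bigcup_(g : int) (T g @` Y)) = 0%E.

Let e (n : nat) : int := odflt 0 (choice.unpickle n).
Let eK g : e (choice.pickle g) = g. Proof. by rewrite /e choice.pickleK. Qed.

Let mTY g : measurable (T g @` Y). Proof. exact: (measurable_act_image _ _ actT). Qed.

Let coverE : \bigcup_(g : int) (T g @` Y) = \bigcup_n (T (e n) @` Y).
Proof.
apply/seteqP; split => x [g _ Yx]; last by exists (e g).
by exists (choice.pickle g) => //; rewrite eK.
Qed.

Let mcover : measurable (\bigcup_(g : int) (T g @` Y)).
Proof. by rewrite coverE; exact: bigcupT_measurable. Qed.

Lemma cut_and_stack_null A : measurable A -> (forall g, mu (T g @` A `&` Y) = 0%E) ->
  mu A = 0%E.
Proof.
move=> mA A0; apply/negligibleP => //.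
apply: (@negligibleS _ _ _ mu
  ((~` \bigcup_(g : int) (T g @` Y)) `|` \bigcup_n (A `&` T (e n) @` Y))).
  move=> x Ax; have [[g _ Yx]|nx] := pselect ((\bigcup_(g : int) (T g @` Y)) x); last by left.
  by right; exists (choice.pickle g) => //; rewrite eK.
apply: negligibleU; first by apply/negligibleP => //; exact: measurableC.
apply: negligible_bigcup => n; apply/negligibleP; first exact: measurableI.
have := A0 (- e n); rewrite -(measure_act_image _ _ actT (e n)); last first.
  by apply: measurableI => //; exact: (measurable_act_image _ _ actT).
by rewrite (act_imageI _ _ actT) (act_image_comp _ _ actT) subrr (act_image0 _ _ actT).
Qed.

Lemma cut_and_stack_sigma_finite : sigma_finite setT mu.
Proof.
exists (fun n => if n is m.+1 then T (e m) @` Y else ~` \bigcup_(g : int) (T g @` Y)).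
  apply/seteqP; split => // x _.
  have [[g _ Yx]|nx] := pselect ((\bigcup_(g : int) (T g @` Y)) x); last by exists 0%N.
  by exists (choice.pickle g).+1 => //; rewrite eK.
move=> [|n]; first by rewrite coverY; split => //; exact: measurableC.
by rewrite (measure_act_image _ _ actT)// muY ltry.
Qed.

(** For a piece A of a translate of a wandering set lying in Y, only the term k = 0 survives, so all
    sums are at most 1 and mu(A)^2 = 0. *)
Lemma cut_and_stack_conservative : conservative mu T.
Proof.
move=> W mW tW; apply: cut_and_stack_null => // g.
set A := _ `&` Y.
have mA : measurable A by apply: measurableI => //; exact: (measurable_act_image _ _ actT).
have AY : A `<=` Y by move=> x [].
have AA l : 0 <= corr l A A <= 1.
  rewrite corrE sumr_ge0//=; case: l => [|l]; first by rewrite big_nil.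
  rewrite big_nat_recl// big1 ?addr0 => [|k _].
    rewrite /c (act_image0 _ _ actT) setIid -[leRHS]/(fine (1%E : \bar R)) -muY.
    by apply: fine_measure_le => //; exact: finY.
  rewrite /c (_ : _ `&` _ = set0) ?measure0// -subset0 => x [[Wx _] [z [Wz _] zx]].
  move/trivIsetP: tW => /(_ g (k.+1%:Z + g) I I) H.
  have {}H : T g @` W `&` T (k.+1%:Z + g) @` W = set0 by apply: H; lia.
  by rewrite -H; split => //; rewrite -(act_image_comp _ _ actT); exists z.
have := ratio_unique A A 1 mA mA AY AY (fun l => AA _).
move=> /eqP; rewrite mulf_eq0 orbb => /eqP A0.
by rewrite -[LHS]fineK ?A0// ge0_fin_numE//; exact: finY.
Qed.

(** No translate of the complement of an invariant set E meets E, so the traces of E and of its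
    complement on Y have zero sums; one trace is null, and translates of Y cover almost
    everything. *)
Lemma cut_and_stack_ergodic : ergodic mu T.
Proof.
move=> E mE invE.
have imE g : T g @` E = E by rewrite (act_imageE _ _ actT).
have mEY : measurable (E `&` Y) by exact: measurableI.
have mCEY : measurable (~` E `&` Y) by apply: measurableI => //; exact: measurableC.
have EY : E `&` Y `<=` Y by move=> x [].
have CEY : ~` E `&` Y `<=` Y by move=> x [].
have imCE g : T g @` (~` E) = ~` E.
  by rewrite (act_imageE _ _ actT) -preimage_setC invE.
have AB l : 0 <= corr l (E `&` Y) (~` E `&` Y) <= 0.
  rewrite corrE big1 ?lexx// => k _; rewrite /c (_ : _ `&` _ = set0) ?measure0//.
  rewrite -subset0 => x [[Ex _] [z [nEz _] zx]].
  by have : (~` E) x; [rewrite -(imCE k%:Z); exists z|apply].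
have := ratio_unique _ _ 0 mEY mCEY EY CEY (fun l => AB _).
have null0 A : measurable A -> A `<=` Y -> fine (mu A) = 0 -> mu A = 0%E.
  by move=> mA AY A0; rewrite -[LHS]fineK ?A0// ge0_fin_numE//; exact: finY.
move=> /eqP; rewrite mulf_eq0 => /orP[]/eqP A0; [left|right].
  by apply: cut_and_stack_null => // g; rewrite imE; exact: null0.
apply: cut_and_stack_null => [|g]; first exact: measurableC.
by rewrite imCE; exact: null0.
Qed.

Lemma cut_and_stack_subseq_weakly_rationally_ergodic :
  (forall n, (h n < h n.+1)%N) -> subseq_weakly_rationally_ergodic mu T.
Proof.
move=> hS; split => //.
- exact: cut_and_stack_sigma_finite.
- exact: cut_and_stack_conservative.
- exact: cut_and_stack_ergodic.
exists h, Y; split => //.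
- move=> n; have := N_gt0 n; rewrite /N lt0n; apply: contraNltn.
  by rewrite leqn0 => /eqP ->; rewrite big_nil.
- by rewrite muY lte01 ltry.
move=> A B mA mB AY BY; rewrite muY /= expr1n.
under eq_fun do rewrite divr1 mulrC.
exact: cut_and_stack_ratio.
Qed.

End CutAndStack.

(** Sets whose trace on Y is approximable by levels form a sigma-algebra. Approximation is required
    at all late stages, not merely at some stage, so that two sets can be treated in the same
    tower. *)
Lemma sigma_algebra_approx {d} {X : measurableType d} {R : realType}
    (mu : {measure set X -> \bar R}) (Y : set X) (E : nat -> nat -> set X)
    (h : nat -> nat) (D : nat -> pred nat) (G : set (set X)) :
  let U n (F : pred nat) := \bigcup_(j in [set j | (j < h n)%N && F j]) E n j in
  measurable Y -> (mu Y < +oo)%E -> (forall n j, measurable (E n j)) ->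
  (forall n, trivIset `I_(h n) (E n)) -> (forall n, Y = U n (D n)) ->
  G `<=` measurable ->
  (forall A, G A -> \forall n \near \oo,
    exists2 F : pred nat, {subset F <= D n} & A `&` Y = U n F) ->
  forall A (e : R), <<s G >> A -> A `<=` Y -> 0 < e ->
    \forall n \near \oo, exists2 F : pred nat, {subset F <= D n} & (mu (A `+` U n F) < e%:E)%E.
Proof.
move=> U mY Yoo mE tE YE Gm GU.
have mU n F : measurable (U n F) by apply: bigcup_measurable => j _; exact: mE.
pose good (A : set X) := measurable A /\ forall e : R, 0 < e -> \forall n \near \oo,
  exists2 F : pred nat, {subset F <= D n} & (mu ((A `&` Y) `+` U n F) < e%:E)%E.
suff goodS : <<s G >> `<=` good.
  move=> A e /goodS[_ Ae] AY e0; have := Ae e e0; rewrite setIidl//.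
have mY' (A B : set X) : measurable A -> measurable B -> measurable (A `+` B).
  by move=> mA mB; rewrite setY_def; apply: measurableU; exact: measurableD.
have muS (A B : set X) : measurable A -> measurable B -> A `<=` B -> (mu A <= mu B)%E.
  by move=> mA mB AB; apply: le_measure; rewrite ?inE.
have good_exact A : measurable A ->
    (\forall n \near \oo, exists2 F : pred nat, {subset F <= D n} & A `&` Y = U n F) -> good A.
  move=> mA AU; split => // e e0; apply: filterS AU => n [F FD ->].
  by exists F => //; rewrite setYK measure0 lte_fin.
have goodU A B : good A -> good B -> good (A `|` B).
  move=> [mA gA] [mB gB]; split; first exact: measurableU.
  move=> e e0; have e20 : 0 < e / 2 by rewrite divr_gt0.
  apply: filterS (filterI (gA _ e20) (gB _ e20)) => n [[F FD AF] [F' FD' BF]].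
  exists [pred j | F j || F' j].
    by move=> j /orP[/FD|/FD'].
  have -> : U n [pred j | F j || F' j] = U n F `|` U n F'.
    apply/seteqP; split => [x [j /= /andP[jh /orP[Fj|Fj]] Ex]|
      x [[j /= /andP[jh Fj] Ex]|[j /= /andP[jh Fj] Ex]]].
    - by left; exists j => //=; rewrite jh.
    - by right; exists j => //=; rewrite jh.
    - by exists j => //=; rewrite jh Fj.
    - by exists j => //=; rewrite jh Fj orbT.
  have mAY := measurableI _ _ mA mY; have mBY := measurableI _ _ mB mY.
  have mAF := mY' _ _ mAY (mU n F); have mBF := mY' _ _ mBY (mU n F').
  apply: (@le_lt_trans _ _ (mu (((A `&` Y) `+` U n F) `|` ((B `&` Y) `+` U n F')))).
    apply: muS; [|exact: measurableU|].
      apply: mY'; last by apply: measurableU; exact: mU.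
      by apply: measurableI => //; apply: measurableU.
    rewrite !setY_def => x; have := EM (U n F x); have := EM (U n F' x).
    rewrite /setU /setI /setD /=; tauto.
  apply: le_lt_trans (measureU2 mu mAF mBF) _.
  by rewrite [e]splitr EFinD lteD.
apply: smallest_sub; last by move=> A GA; apply: good_exact; [exact: Gm|exact: GU].
split.
- apply: good_exact => //; apply: nearW => n; exists pred0 => //.
  by rewrite set0I; apply/esym; rewrite -subset0 => x [j]; rewrite /= andbF.
- move=> A [mA gA]; rewrite setTD; split; first exact: measurableC.
  move=> e e0; apply: filterS (gA e e0) => n [F FD AF].
  (* Complements are taken among the levels of Y, which leaves the symmetric difference inside Y
     unchanged. *)
  exists [pred j | D n j && ~~ F j]; first by move=> j /andP[].
  apply: le_lt_trans AF; apply: muS.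
  + by apply: mY' => //; apply: measurableI => //; exact: measurableC.
  + by apply: mY' => //; exact: measurableI.
  have UY : U n F `<=` Y.
    by rewrite (YE n) => x [j /= /andP[jh Fj] Ex]; exists j => //=; rewrite jh; exact: FD.
  have -> : U n [pred j | D n j && ~~ F j] = Y `\` U n F.
    apply/seteqP; split => x.
      move=> [j /= /andP[jh /andP[Dj Fj]] Ex]; split.
        by rewrite (YE n); exists j => //=; rewrite jh.
      move=> [k /= /andP[kh Fk] Ekx].
      have [jk|jk] := eqVneq j k; first by rewrite jk Fk in Fj.
      move/trivIsetP: (tE n) => /(_ j k jh kh jk) jk0.
      by have [] : set0 x by rewrite -jk0.
    rewrite {1}(YE n) => -[[j /= /andP[jh Dj] Ex] nU].
    exists j => //=; rewrite jh [D n j]Dj /=; apply/negP => Fj.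
    by apply: nU; exists j => //=; rewrite jh.
  rewrite !setY_def => x; have := UY x; have := EM (U n F x); have := EM (A x).
  rewrite /setU /setI /setD /setC /=; tauto.
- move=> A gA.
  have mA k : measurable (A k) by have [] := gA k.
  have mUA : measurable (\bigcup_k A k) by exact: bigcupT_measurable.
  pose B k := \big[setU/set0]_(i < k) A i.
  have gB k : good (B k).
    elim: k => [|k IH]; last by rewrite /B big_ord_recr; exact: goodU.
    rewrite /B big_ord0; apply: good_exact => //; apply: nearW => n; exists pred0 => //.
    by rewrite set0I; apply/esym; rewrite -subset0 => x [j]; rewrite /= andbF.
  split => // e e0; have e20 : 0 < e / 2 by rewrite divr_gt0.
  (* Adding the complement of the full union makes Z_k increase to the whole space, while Y \ Z_k is
     exactly the part of the union in Y missed by the k-th partial union. *)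
  pose Z k := B k `|` ~` \bigcup_k A k.
  have mB k : measurable (B k) by have [] := gB k.
  have mZ k : measurable (Z k) by apply: measurableU => //; exact: measurableC.
  have [k Ak] : exists k, (mu (Y `\` Z k) < (e / 2)%:E)%E.
    apply: (@filter_ex _ \oo); apply: measure_exhaustion_small => //.
      move=> n m nm; rewrite subsetEset; apply: setSU.
      by rewrite /B -!bigcup_mkord; apply: bigcup_subset => i /= /leq_trans; apply.
    apply/seteqP; split => // x _.
    have [[i _ Aix]|nA] := pselect ((\bigcup_k A k) x); last by exists 0%N => //; right.
    by exists i.+1 => //; left; rewrite /B big_ord_recr /=; right.
  have [_ /(_ _ e20)] := gB k; apply: filterS => n [F FD BF]; exists F => //.
  have mBY := measurableI _ _ (mB k) mY.
  have mBF := mY' _ _ mBY (mU n F); have mYZ := measurableD mY (mZ k).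
  apply: (@le_lt_trans _ _ (mu ((Y `\` Z k) `|` ((B k `&` Y) `+` U n F)))).
    apply: muS; [|exact: measurableU|].
      by apply: mY' => //; exact: measurableI.
    have BA : B k `<=` \bigcup_k A k.
      by rewrite /B -bigcup_mkord => x [i _ Aix]; exists i.
    rewrite !setY_def => x; have := BA x; have := EM (U n F x); have := EM (B k x).
    have := EM ((\bigcup_k A k) x).
    rewrite /Z /setU /setI /setD /setC /=; tauto.
  apply: le_lt_trans (measureU2 mu mYZ mBF) _.
  by rewrite [e]splitr EFinD lteD.
Qed.

(** * The (C,F)-space *)

Section Points.
Variable D : cf_data.
Local Notation F := (cfF D).
Local Notation C := (cfC D).
Implicit Types p q r : cf_space D.

(* [cf_at n x p]: x is the coordinate sequence of p as a point of X_n. *)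
Definition cf_at (n : nat) (x : nat -> int) (p : cf_space D) : Prop :=
  exists z : cf_level D n, p = cf_pt z /\ \val z = x.

Definition cf_translate (g : int) (x : nat -> int) (i : nat) : int :=
  if i is j.+1 then x j.+1 else g + x 0%N.

(** An inverse of the j-fold embedding: the coordinates of [x] up to j followed by the tail of [w].
    It maps to [w] as soon as [w 0] is the sum of those first coordinates. *)
Definition cf_splice (x : nat -> int) (j : nat) (w : nat -> int) (i : nat) : int :=
  if (i <= j)%N then x i else w (i - j)%N.

Lemma iter_embed0 j x : iter j cf_embed x 0%N = \sum_(0 <= k < j.+1) x k.
Proof.
elim: j x => [|j IH] x; first by rewrite big_nat1.
by rewrite iterSr IH [RHS]big_nat_recl// [in RHS]big_nat_recl// big_nat_recl//= addrA.
Qed.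

Lemma iter_embedS j x i : iter j cf_embed x i.+1 = x (i.+1 + j)%N.
Proof.
elim: j x => [|j IH] x; first by rewrite addn0.
by rewrite iterSr IH /= addSn addnS.
Qed.

Lemma iter_embed_translate j g x :
  iter j cf_embed (cf_translate g x) = cf_translate g (iter j cf_embed x).
Proof.
apply/funext => -[|i]; last by rewrite /= !iter_embedS addSn.
by rewrite /cf_translate !iter_embed0 !(big_nat_recl j)//= addrA.
Qed.

Lemma cf_level_embed n j x : cf_level D n x -> cf_level D (n + j)%N (iter j cf_embed x).
Proof.
elim: j n x => [|j IH] n x xn; first by rewrite addn0.
rewrite addnS iterS.
have [x0 xC] := IH n x xn; split => [|i] /=.
  apply: (fsubsetP (cfFC_sub D (n + j))); apply/imfset2P.
  exists (iter j cf_embed x 0%N) => //; exists (iter j cf_embed x 1%N) => //.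
  by have := xC 0%N; rewrite addn1.
by have := xC i.+1; rewrite addnS addSn.
Qed.

Lemma cf_splice0 x j w : cf_splice x j w 0%N = x 0%N. Proof. by []. Qed.

Lemma iter_embed_splice x j w : w 0%N = \sum_(0 <= k < j.+1) x k ->
  iter j cf_embed (cf_splice x j w) = w.
Proof.
move=> w0; apply/funext => -[|i]; last first.
  by rewrite iter_embedS /cf_splice addSn ltnNge leq_addl /= subSn ?leq_addl// addnK.
rewrite iter_embed0 w0; apply: eq_big_nat => k /andP[_ kj].
by rewrite /cf_splice -ltnS kj.
Qed.

Lemma cf_level_splice n x j w : cf_level D n x -> cf_level D (n + j)%N w ->
  cf_level D n (cf_splice x j w).
Proof.
move=> [x0 xC] [_ wC]; split => // i; rewrite /cf_splice.
case: leqP => ij //; rewrite subSn//; have := wC (i - j)%N.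
by rewrite -addnA addnS subnKC.
Qed.

Lemma cf_at_level n x p : cf_at n x p -> cf_level D n x.
Proof. by move=> [[z zn] [_ <-]]; exact: set_mem. Qed.

Lemma cf_atP n x : cf_level D n x -> exists p, cf_at n x p.
Proof. by move=> /mem_set xn; exists (cf_pt (exist _ x xn)), (exist _ x xn). Qed.

Lemma cf_pt_eq n m (z : cf_level D n) (w : cf_level D m) : cf_pt z = cf_pt w <->
  exists i j, (n + i = m + j)%N /\ iter i cf_embed (\val z) = iter j cf_embed (\val w).
Proof.
split => [/eqmodP/asboolP //|H].
by apply/eqmodP; apply/asboolP.
Qed.

Lemma cf_at_lift n x p j : cf_at n x p -> cf_at (n + j)%N (iter j cf_embed x) p.
Proof.
move=> xp; have /mem_set xn := cf_level_embed _ j _ (cf_at_level _ _ _ xp).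
move: xp => [z [-> zx]]; exists (exist _ (iter j cf_embed x) xn); split => //.
by apply/cf_pt_eq; exists j, 0%N; rewrite addn0 zx.
Qed.

Lemma cf_at_fun n x p q : cf_at n x p -> cf_at n x q -> p = q.
Proof.
move=> [z [-> zx]] [w [-> wx]]; congr cf_pt; apply/val_inj.
by rewrite zx wx.
Qed.

Lemma cf_at_unembed n x j q w : cf_level D n x -> iter j cf_embed x = w ->
  cf_at (n + j)%N w q -> cf_at n x q.
Proof.
move=> /cf_atP[p xp] xw wq; move: (cf_at_lift _ _ _ j xp); rewrite xw => wp.
by rewrite (cf_at_fun _ _ _ _ wq wp).
Qed.

(** Condition (III): the translates F_n + c are disjoint, so f_n + c_(n+1) determines c_(n+1) and
    then f_n. *)
Lemma cf_embed_inj n x y : cf_level D n x -> cf_level D n y ->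
  cf_embed x = cf_embed y -> x = y.
Proof.
move=> [x0 xC] [y0 yC] xy.
have xyS i : x i.+2 = y i.+2 by have := congr1 (fun f => f i.+1) xy.
have xy0 : x 0%N + x 1%N = y 0%N + y 1%N by have := congr1 (fun f => f 0%N) xy.
have xy1 : x 1%N = y 1%N.
  apply/eqP/contraT => xy1.
  have x1 := xC 0%N; have y1 := yC 0%N; rewrite addn1 in x1 y1.
  have /fdisjointP/(_ (x 0%N + x 1%N)) := cfFC_disj x1 y1 xy1.
  have -> : x 0%N + x 1%N \in fsumset (F n) [fset x 1%N]%fset.
    by apply/imfset2P; exists (x 0%N) => //; exists (x 1%N) => //; rewrite inE.
  move=> /(_ isT); rewrite xy0 => /negP[].
  by apply/imfset2P; exists (y 0%N) => //; exists (y 1%N) => //; rewrite inE.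
apply/funext => -[|[|i]] //.
by move: xy0; rewrite xy1 => /addIr.
Qed.

Lemma cf_at_inj n x y p : cf_at n x p -> cf_at n y p -> x = y.
Proof.
move=> xp yp; have xn := cf_at_level _ _ _ xp; have yn := cf_at_level _ _ _ yp.
move: xp yp => [z [-> zx]] [w [/cf_pt_eq[i [j [/addnI <- ij]]] wy]].
rewrite zx wy in ij; elim: i ij => [//|i IH]; rewrite !iterS => H; apply: IH.
exact: (cf_embed_inj (n + i) _ _ (cf_level_embed _ _ _ xn) (cf_level_embed _ _ _ yn) H).
Qed.

Lemma cf_at_surj p : exists n x, cf_at n x p.
Proof.
have <- := reprK p; case: (repr p) => n z.
by exists n, (\val z), z.
Qed.

Lemma cf_cylE n (A : {fset int}) p :
  cf_cyl D n A p <-> exists2 x, cf_at n x p & x 0%N \in A.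
Proof.
split => [[z [-> zA]]|[x [z [-> zx]] xA]]; first by exists (\val z) => //; exists z.
by exists z; rewrite zx.
Qed.

Lemma cf_moveE g p q :
  cf_move g p q <-> exists n x, cf_at n x p /\ cf_at n (cf_translate g x) q.
Proof.
split => [[n [x [y [-> -> y0 yS]]]]|[n [x [[z [-> zx]] [w [-> wx]]]]]].
  exists n, (\val x); split; first by exists x.
  exists y; split => //.
  by apply/funext => -[|i]; [exact: y0|exact: yS].
by exists n, z, w; split => //; rewrite wx zx.
Qed.


Lemma cf_at_common n x m y p : cf_at n x p -> cf_at m y p ->
  iter (maxn n m - n) cf_embed x = iter (maxn n m - m) cf_embed y.
Proof.
move=> xp yp; apply: (cf_at_inj (maxn n m) _ _ p).
  by have := cf_at_lift _ _ _ (maxn n m - n) xp; rewrite subnKC ?leq_maxl.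
by have := cf_at_lift _ _ _ (maxn n m - m) yp; rewrite subnKC ?leq_maxr.
Qed.

(** Translation commutes with the embeddings, so a move seen at one level is seen at all later ones;
    two moves can then be compared at a common level. *)
Lemma cf_move_at g p q : cf_move g p q ->
  exists n0, forall n, (n0 <= n)%N ->
    exists x, cf_at n x p /\ cf_at n (cf_translate g x) q.
Proof.
move=> /cf_moveE[n0 [x [xp xq]]]; exists n0 => n n0n.
exists (iter (n - n0) cf_embed x); rewrite -iter_embed_translate -(subnKC n0n) addKn.
by split; exact: cf_at_lift.
Qed.

Lemma cf_translateD g h x : cf_translate g (cf_translate h x) = cf_translate (g + h) x.
Proof. by apply/funext => -[|i] //=; rewrite addrA. Qed.

Lemma cf_translate0 x : cf_translate 0 x = x.
Proof. by apply/funext => -[|i] //=; rewrite add0r. Qed.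

Lemma cf_move_fun g p q r : cf_move g p q -> cf_move g p r -> q = r.
Proof.
move=> /cf_move_at[n Hn] /cf_move_at[m Hm].
have [x [xp xq]] := Hn _ (leq_maxl n m); have [y [yp yr]] := Hm _ (leq_maxr n m).
by rewrite (cf_at_inj _ _ _ _ xp yp) in xq; exact: cf_at_fun xq yr.
Qed.

Lemma cf_moveD g h p q r : cf_move h p q -> cf_move g q r -> cf_move (g + h) p r.
Proof.
move=> /cf_move_at[n Hn] /cf_move_at[m Hm].
have [x [xp xq]] := Hn _ (leq_maxl n m); have [y [yq yr]] := Hm _ (leq_maxr n m).
apply/cf_moveE; exists (maxn n m), x; split => //.
by rewrite -cf_translateD (cf_at_inj _ _ _ _ xq yq).
Qed.

Lemma cf_moveN g p q : cf_move g p q -> cf_move (- g) q p.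
Proof.
move=> /cf_moveE[n [x [xp xq]]]; apply/cf_moveE; exists n, (cf_translate g x).
by rewrite cf_translateD addNr cf_translate0.
Qed.

Lemma cf_move0 p : cf_move 0 p p.
Proof.
have [n [x xp]] := cf_at_surj p; apply/cf_moveE.
by exists n, x; rewrite cf_translate0.
Qed.

Definition cf_good : set (cf_space D) :=
  [set p : cf_space D | forall g, exists q, cf_move g p q].

Lemma cf_act_move g p : cf_good p -> cf_move g p (cf_act D g p).
Proof.
move=> pg; rewrite /cf_act; case: asboolP => // _.
have [q pq] := pg g; exact: (@xgetPex _ p [set q | cf_move g p q] (ex_intro _ q pq)).
Qed.

Lemma cf_act_bad g p : ~ cf_good p -> cf_act D g p = p.
Proof. by rewrite /cf_act => pb; case: asboolP. Qed.

Lemma cf_good_move g p q : cf_good p -> cf_move g p q -> cf_good q.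
Proof.
move=> pg pq k; have [r pr] := pg (k + g).
by exists r; rewrite -(addrK g k); apply: cf_moveD pr; exact: cf_moveN.
Qed.

Lemma cf_act_good g p : cf_good (cf_act D g p) <-> cf_good p.
Proof.
have [pg|pb] := pselect (cf_good p); last by rewrite cf_act_bad.
by split => // _; apply: cf_good_move (cf_act_move g _ pg).
Qed.

Lemma cf_act0 p : cf_act D 0 p = p.
Proof.
have [pg|pb] := pselect (cf_good p); last by rewrite cf_act_bad.
exact: cf_move_fun (cf_act_move 0 _ pg) (cf_move0 p).
Qed.

Lemma cf_actD g h p : cf_act D (g + h) p = cf_act D g (cf_act D h p).
Proof.
have [pg|pb] := pselect (cf_good p); last by rewrite !cf_act_bad.
apply: cf_move_fun (cf_act_move _ _ pg) _.
apply: cf_moveD (cf_act_move _ _ pg) _; apply: cf_act_move.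
exact/cf_act_good.
Qed.

Lemma cf_cyl_move g n f p q : f \in F n -> g + f \in F n ->
  cf_cyl D n [fset f]%fset p -> cf_move g p q -> cf_cyl D n [fset (g + f)%R]%fset q.
Proof.
move=> fF gF /cf_cylE[x xp]; rewrite inE => /eqP x0 pq.
have /cf_atP[r xr] : cf_level D n (cf_translate g x).
  by have [_ xC] := cf_at_level _ _ _ xp; split => //=; rewrite x0.
have pr : cf_move g p r by apply/cf_moveE; exists n, x.
rewrite (cf_move_fun _ _ _ _ pq pr); apply/cf_cylE.
by exists (cf_translate g x) => //=; rewrite x0 inE.
Qed.

Lemma cf_cyl_ex_move g n f p : g + f \in F n ->
  cf_cyl D n [fset f]%fset p -> exists q, cf_move g p q.
Proof.
move=> gF /cf_cylE[x xp]; rewrite inE => /eqP x0.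
have /cf_atP[r xr] : cf_level D n (cf_translate g x).
  by have [_ xC] := cf_at_level _ _ _ xp; split => //=; rewrite x0.
by exists r; apply/cf_moveE; exists n, x.
Qed.

Lemma cf_cyl_F n f p : cf_cyl D n [fset f]%fset p -> f \in F n.
Proof. by move=> /cf_cylE[x /cf_at_level[x0 _]]; rewrite inE => /eqP <-. Qed.

Lemma cf_cyl_disj n f f' p : cf_cyl D n [fset f]%fset p -> cf_cyl D n [fset f']%fset p ->
  f = f'.
Proof.
move=> /cf_cylE[x xp]; rewrite inE => /eqP <- /cf_cylE[y yp]; rewrite inE => /eqP <-.
by rewrite (cf_at_inj _ _ _ _ xp yp).
Qed.

Lemma cf_cyl_bigcup n (A : {fset int}) p :
  cf_cyl D n A p <-> exists2 f, f \in A & cf_cyl D n [fset f]%fset p.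
Proof.
split=> [/cf_cylE[x xp xA]|[f fA /cf_cylE[x xp]]].
  by exists (x 0%N) => //; apply/cf_cylE; exists x => //; rewrite inE.
by rewrite inE => /eqP xf; apply/cf_cylE; exists x => //; rewrite xf.
Qed.

(** A common point p shows that f' is f plus chosen elements of C_(n+1), ..., C_(n+j). Splicing
    these coordinates of p into any point over f' exhibits it as a point over f. *)
Lemma cf_cyl_nested n j f f' p : cf_cyl D n [fset f]%fset p ->
  cf_cyl D (n + j) [fset f']%fset p ->
  cf_cyl D (n + j) [fset f']%fset `<=` cf_cyl D n [fset f]%fset.
Proof.
move=> /cf_cylE[x xp]; rewrite inE => /eqP xf /cf_cylE[z zp]; rewrite inE => /eqP zf q.
move=> /cf_cylE[w wq]; rewrite inE => /eqP wf.
have w0 : w 0%N = \sum_(0 <= k < j.+1) x k.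
  by rewrite wf -zf (cf_at_inj _ _ _ _ zp (cf_at_lift _ _ _ j xp)) iter_embed0.
apply/cf_cylE; exists (cf_splice x j w); last by rewrite cf_splice0 xf inE.
apply: (cf_at_unembed _ _ _ _ _ _ (iter_embed_splice _ _ _ w0) wq).
by apply: cf_level_splice; [exact: cf_at_level xp|exact: cf_at_level wq].
Qed.

Lemma cf_cyl_step n (A : {fset int}) : (A `<=` F n)%fset ->
  cf_cyl D n A = cf_cyl D n.+1 (fsumset A (C n.+1)).
Proof.
move=> AF; apply/seteqP; split => p /cf_cylE[x xp xA]; apply/cf_cylE.
  exists (cf_embed x); first by have := cf_at_lift _ _ _ 1 xp; rewrite addn1.
  apply/imfset2P; exists (x 0%N) => //; exists (x 1%N) => //.
  by have [_ /(_ 0%N)] := cf_at_level _ _ _ xp; rewrite addn1.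
move: xA => /imfset2P[a aA [c cC xac]].
pose y i := if i is j.+1 then (if j is k.+1 then x j else c) else a.
have [x0 xC] := cf_at_level _ _ _ xp.
exists y => //; apply: (@cf_at_unembed n y 1 p x); last by rewrite addn1.
  split => [|[|i]] /=; [exact: (fsubsetP AF)|by rewrite addn1|].
  by have := xC i; rewrite addSnnS.
by apply/funext => -[|i] /=.
Qed.

Lemma cf_sumset_sub n k : (cf_sumset D n k `<=` F (n + k))%fset.
Proof.
elim: k => [|k IH] /=; first by rewrite addn0.
rewrite addnS; apply: fsubset_trans (cfFC_sub D (n + k)).
apply/fsubsetP => z /imfset2P[a /(fsubsetP IH) aF [c cC ->]].
by apply/imfset2P; exists a => //; exists c.
Qed.

Lemma cf_cyl_sumset n k : cf_cyl D n (F n) = cf_cyl D (n + k) (cf_sumset D n k).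
Proof.
elim: k => [|k ->] /=; first by rewrite addn0.
by rewrite addnS cf_cyl_step//; exact: cf_sumset_sub.
Qed.

End Points.

(** * Topology and Borel sets of the (C,F)-space *)

Section Topology.
Variable D : cf_data.

Lemma nbhs_ptws_discrete (x : {ptws nat -> discrete_topology int}) j :
  nbhs x [set y | forall i, (i <= j)%N -> y i = x i].
Proof.
have FF : Filter (nbhs x) := nbhs_filter x.
have H i : nbhs x [set y : {ptws nat -> discrete_topology int} | y i = x i].
  exact: (@proj_continuous nat (fun=> discrete_topology int) i x [set z | z = x i]).
elim: j => [|j IH]; first by apply: filterS (H 0%N) => y y0 i; rewrite leqn0 => /eqP ->.
apply: filterS (filterI IH (H j.+1)) => y [yj yS] i; rewrite leq_eqVlt ltnS => /orP[/eqP ->//|].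
exact: yj.
Qed.

Lemma cf_open_at (V : set (cf_space D)) :
  (forall n x p, cf_at D n x p -> V p -> exists j, forall y q, cf_at D n y q ->
    (forall i, (i <= j)%N -> y i = x i) -> V q) -> open V.
Proof.
move=> HV; rewrite /open /= /quotient_open; apply/sigT_openP => n.
rewrite openE => z Vz.
have [j Hj] := HV n (\val z) _ (ex_intro _ z (conj erefl erefl)) Vz.
have H : nbhs z (set_val @^-1` [set y | forall i, (i <= j)%N -> y i = \val z i]) :=
  @initial_continuous _ _ (@set_val _ (cf_level D n)) z _ (nbhs_ptws_discrete (\val z) j).
apply: filterS H => w Ww.
by apply: (Hj (\val w)) => //; exists w.
Qed.

(** Otherwise there would be points outside V agreeing with [x] on longer and longer initial
    segments; they converge to [x] pointwise, hence eventually enter V. *)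
Lemma cf_at_open (V : set (cf_space D)) n x p : open V -> cf_at D n x p -> V p ->
  exists j, forall y q, cf_at D n y q ->
    (forall i, (i <= j)%N -> y i = x i) -> V q.
Proof.
rewrite /open /= /quotient_open => /sigT_openP/(_ n) oV [z [-> zx]] Vz.
move: oV => [W oW WV].
have WE (w : cf_level D n) : W (\val w) <-> V (cf_pt w).
  by have : (set_val @^-1` W) w <-> V (cf_pt w) by rewrite WV.
have Wz : W (\val z) by exact/WE.
apply: contrapT => /forallNP H.
have {}H j : exists w : cf_level D n, (forall i, (i <= j)%N -> \val w i = x i) /\ ~ V (cf_pt w).
  apply: contrapT => /forallNP H'; apply: (H j) => y q [w [-> wy]] yx.
  apply: contrapT => nV; apply: (H' w); split => // i ij.
  by rewrite wy; exact: yx.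
have /choice[w Hw] := H.
have : \val (w j) @[j --> \oo] --> (\val z : {ptws nat -> discrete_topology int}).
  apply/pointwise_cvgP => t U Ut; exists t => // j /= tj.
  have [wj _] := Hw j; rewrite /= wj// -zx.
  exact: nbhs_singleton Ut.
move=> /(_ W (open_nbhs_nbhs (conj oW Wz))) [j _ /(_ j (leqnn j))] /= /WE.
by have [_] := Hw j.
Qed.

Lemma cf_cyl_open n (A : {fset int}) : open (cf_cyl D n A).
Proof.
apply: cf_open_at => m x p xp /cf_cylE[y yp yA].
pose i := (maxn m n - m)%N; pose j := (maxn m n - n)%N.
exists i => x' q x'q xx'.
have xy := cf_at_common _ _ _ _ _ _ xp yp.
have sumx : iter i cf_embed x' 0%N = iter i cf_embed x 0%N.
  by rewrite !iter_embed0; apply: eq_big_nat => k /andP[_ ki]; exact: xx'.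
have w0 : iter i cf_embed x' 0%N = \sum_(0 <= k < j.+1) y k.
  by rewrite sumx xy iter_embed0.
have wq : cf_at D (n + j) (iter i cf_embed x') q.
  have := cf_at_lift _ _ _ _ i x'q; rewrite /i /j subnKC ?leq_maxl// subnKC ?leq_maxr//.
apply/cf_cylE; exists (cf_splice y j (iter i cf_embed x')) => //.
apply: (cf_at_unembed _ _ _ _ _ _ _ (iter_embed_splice _ _ _ w0) wq).
by apply: cf_level_splice; [exact: cf_at_level yp|exact: cf_at_level wq].
Qed.

Lemma cf_open_cyl (V : set (cf_space D)) p : open V -> V p ->
  exists n f, cf_cyl D n [fset f]%fset p /\ cf_cyl D n [fset f]%fset `<=` V.
Proof.
move=> oV Vp; have [n [x xp]] := cf_at_surj D p.
have [j Hj] := cf_at_open _ _ _ _ oV xp Vp.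
exists (n + j)%N, (iter j cf_embed x 0%N); split.
  apply/cf_cylE; exists (iter j cf_embed x); first exact: cf_at_lift.
  by rewrite inE.
move=> q /cf_cylE[w wq]; rewrite inE iter_embed0 => /eqP w0.
apply: (Hj (cf_splice x j w)); last by move=> i ij; rewrite /cf_splice ij.
apply: (cf_at_unembed _ _ _ _ _ _ _ (iter_embed_splice _ _ _ w0) wq).
by apply: cf_level_splice; [exact: cf_at_level xp|exact: cf_at_level wq].
Qed.

Lemma cf_cyl_measurable n (A : {fset int}) :
  measurable (cf_cyl D n A : set (cf_borel D)).
Proof. by apply: sub_sigma_algebra; exact: cf_cyl_open. Qed.

(** The empty set is included because two cylinders are nested or disjoint: this makes a
    pi-system. *)
Definition cf_cylinders : set (set (cf_borel D)) :=
  [set A | A = set0 \/ exists n f, A = cf_cyl D n [fset f]%fset].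

Lemma cf_cylinders_setI : setI_closed cf_cylinders.
Proof.
have main n m f g : (n <= m)%N ->
    cf_cylinders (cf_cyl D n [fset f]%fset `&` cf_cyl D m [fset g]%fset).
  move=> nm; have [[p [Lp Mp]]|nLM] := pselect (exists p, cf_cyl D n [fset f]%fset p /\
      cf_cyl D m [fset g]%fset p).
    right; exists m, g; apply: setIidr; rewrite -(subnKC nm) in Mp *.
    exact: cf_cyl_nested Lp Mp.
  by left; rewrite -subset0 => p [Lp Mp]; apply: nLM; exists p.
move=> A B [->|[n [f ->]]] [->|[m [g ->]]]; rewrite ?set0I ?setI0; try by left.
have [nm|/ltnW mn] := leqP n m; first exact: main.
by rewrite setIC; exact: main.
Qed.

(** Cylinders form a base and there are countably many of them, so an open set is the countable
    union of the cylinders it contains. *)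
Lemma cf_borelE : (measurable : set (set (cf_borel D))) = <<s cf_cylinders >>.
Proof.
apply/seteqP; split; last first.
  apply: smallest_sub; first exact: sigma_algebra_measurable.
  by move=> A [->//|[n [f ->]]]; exact: cf_cyl_measurable.
apply: smallest_sub; first exact: smallest_sigma_algebra.
move=> V oV.
pose e (k : nat) : nat * int := odflt (0%N, 0) (choice.unpickle k).
have eK q : e (choice.pickle q) = q by rewrite /e choice.pickleK.
have -> : V = \bigcup_k (if `[< cf_cyl D (e k).1 [fset (e k).2]%fset `<=` V >]
    then cf_cyl D (e k).1 [fset (e k).2]%fset else set0).
  apply/seteqP; split => [p Vp|p [k _]]; last first.
    by case: asboolP => [LV Lp|//]; exact: LV.
  have [n [f [Lp LV]]] := cf_open_cyl _ _ oV Vp.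
  by exists (choice.pickle (n, f)) => //; rewrite eK /=; case: asboolP.
apply: sigma_algebra_bigcup => k; apply: sub_sigma_algebra.
by case: asboolP => _; [right; exists (e k).1, (e k).2|left].
Qed.

End Topology.

Lemma cf_F_neq0 (D : cf_data) n : exists f, f \in cfF D n.
Proof.
elim: n => [|n [f fF]]; first by exists 0; rewrite cfF0 inE.
have [c cC] := cfC_neq0 D n; exists (f + c).
by apply: (fsubsetP (cfFC_sub D n)); apply/imfset2P; exists f => //; exists c.
Qed.

(** * The (C,F)-action preserves the (C,F)-measure *)

Section CFMeasure.
Context {R : realType}.
Variables (D : cf_data) (mu : {measure set (cf_borel D) -> \bar R}).
Local Notation F := (cfF D).
Local Notation C := (cfC D).
Hypotheses (cond : cf_condition D R) (muD : cf_measure mu).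

Definition cf_cardC n := (\prod_(1 <= j < n.+1) #|` C j|)%N.

Lemma cf_cardC_ge n : (2 ^ n <= cf_cardC n)%N.
Proof.
rewrite /cf_cardC; elim: n => [|n IH]; first by rewrite big_nil.
by rewrite big_nat_recr//= expnSr; apply: leq_mul => //; exact: cfC_gt1.
Qed.

Lemma cf_cardC_gt0 n : (0 < cf_cardC n)%N.
Proof. by apply: leq_trans (cf_cardC_ge n); rewrite expn_gt0. Qed.

Lemma cf_measure_cyl n (A : {fset int}) : (A `<=` F n)%fset ->
  mu (cf_cyl D n A) = (#|` A|%:R / (cf_cardC n)%:R)%:E.
Proof. by have [_] := muD; exact. Qed.

Lemma cf_measure_cyl1 n f : f \in F n ->
  mu (cf_cyl D n [fset f]%fset) = ((cf_cardC n)%:R^-1)%:E.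
Proof. by move=> fF; rewrite cf_measure_cyl ?fsub1set// cardfs1 mul1r. Qed.

Lemma cf_measure_cyl1_lty n f : (mu (cf_cyl D n [fset f]%fset) < +oo)%E.
Proof.
have [fF|fF] := boolP (f \in F n); first by rewrite cf_measure_cyl1// ltry.
rewrite (_ : cf_cyl _ _ _ = set0) ?measure0 ?ltry//.
by rewrite -subset0 => p /cf_cyl_F; rewrite (negbTE fF).
Qed.

Let dom g : set (cf_borel D) := [set p | exists q, cf_move g p q].

Let e (k : nat) : nat * int := odflt (0%N, 0) (choice.unpickle k).
Let eK q : e (choice.pickle q) = q. Proof. by rewrite /e choice.pickleK. Qed.
Let ez (k : nat) : int := odflt 0 (choice.unpickle k).
Let ezK q : ez (choice.pickle q) = q. Proof. by rewrite /ez choice.pickleK. Qed.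

Let measurable_choice (Q : nat -> int -> Prop) :
  measurable ([set p | exists n f, Q n f /\ cf_cyl D n [fset f]%fset p] : set (cf_borel D)).
Proof.
rewrite (_ : [set p | _] = \bigcup_k (if `[< Q (e k).1 (e k).2 >]
    then cf_cyl D (e k).1 [fset (e k).2]%fset else set0)).
  apply: bigcupT_measurable => k; case: asboolP => // _; exact: cf_cyl_measurable.
apply/seteqP; split => [p [n [f [Qn Lp]]]|p [k _]].
  by exists (choice.pickle (n, f)) => //; rewrite eK /=; case: asboolP.
by case: asboolP => // Qk Lp; exists (e k).1, (e k).2.
Qed.

Let domE g : dom g = [set p | exists n f, (g + f)%R \in F n /\ cf_cyl D n [fset f]%fset p].
Proof.
apply/seteqP; split => p.
  move=> [q /cf_moveE[n [x [xp xq]]]]; exists n, (x 0%N); split.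
    by have [] := cf_at_level _ _ _ _ xq.
  by apply/cf_cylE; exists x => //; rewrite inE.
by move=> [n [f [gF Lp]]]; exact: cf_cyl_ex_move gF Lp.
Qed.

Let mdom g : measurable (dom g). Proof. by rewrite domE; exact: measurable_choice. Qed.

Let goodE : cf_good D = \bigcap_k dom (ez k).
Proof.
apply/seteqP; split => [p pg k _|p pd g]; first exact: pg.
by have := pd (choice.pickle g) I; rewrite ezK.
Qed.

Lemma cf_good_measurable : measurable (cf_good D : set (cf_borel D)).
Proof. by rewrite goodE; apply: bigcapT_measurable => k; exact: mdom. Qed.

Let mcyl n A := cf_cyl_measurable D n A.

(** The points of X_n at which T_g is defined by level n + k form a cylinder over [A k], of relative
    measure r_k in X_n. The standing assumption says that r_k tends to 1. *)
Lemma cf_dom_conull g n : (0 < n)%N -> mu (cf_cyl D n (F n) `\` dom g) = 0%E.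
Proof.
move=> n0.
pose S k := cf_sumset D n k.
pose A k := [fset z in S k | (g + z)%R \in F (n + k)]%fset.
have AS k : (A k `<=` S k)%fset by apply/fsubsetP => z; rewrite !inE => /andP[].
have AF k : (A k `<=` F (n + k))%fset := fsubset_trans (AS k) (cf_sumset_sub D n k).
have cardA k : #|` A k| = #|` fsumset [fset g] (S k) `&` F (n + k)|%fset.
  have <- : ([fset (g + z)%R | z in A k] = fsumset [fset g] (S k) `&` F (n + k))%fset.
    apply/fsetP => z; apply/imfsetP/idP.
      move=> [w]; rewrite !inE => /andP[wS gF] ->; rewrite gF andbT.
      by apply/imfset2P; exists g; [rewrite inE|exists w].
    rewrite inE => /andP[/imfset2P[g']]; rewrite inE => /eqP -> [w wS ->] gF.
    by exists w => //; rewrite !inE wS.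
  by rewrite [RHS]card_imfset// => ? ? /addrI.
have sub k : cf_cyl D n (F n) `\` dom g `<=` cf_cyl D n (F n) `\` cf_cyl D (n + k) (A k).
  apply: setDS => p /cf_cyl_bigcup[z]; rewrite !inE => /andP[_ gF].
  exact: cf_cyl_ex_move.
have AX k : cf_cyl D (n + k) (A k) `<=` cf_cyl D n (F n).
  rewrite (cf_cyl_sumset D n k) => p /cf_cyl_bigcup[z zA Lp].
  by apply/cf_cyl_bigcup; exists z => //; exact: (fsubsetP (AS k)).
have cardCD k : cf_cardC (n + k) = (cf_cardC n * \prod_(n.+1 <= j < (n + k).+1) #|` C j|)%N.
  by rewrite /cf_cardC (@big_cat_nat _ _ _ n.+1)// ltnS leq_addr.
have muX : mu (cf_cyl D n (F n)) = (#|` F n|%:R / (cf_cardC n)%:R)%:E by exact: cf_measure_cyl.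
set a := _ / _ in muX.
pose r k : R := #|` fsumset [fset g] (S k) `&` F (n + k)|%fset%:R /
  (#|` F n| * \prod_(n.+1 <= j < (n + k).+1) #|` C j|)%N%:R.
have muA k : mu (cf_cyl D (n + k) (A k)) = (r k * a)%:E.
  rewrite cf_measure_cyl// cardA cardCD; congr EFin; rewrite /r /a.
  have Pn0 : (\prod_(n.+1 <= j < (n + k).+1) #|` C j|)%N != 0%N.
    by have := cf_cardC_gt0 (n + k); rewrite cardCD muln_gt0 => /andP[_]; rewrite lt0n.
  have Fn0 : #|` F n| != 0%N.
    by rewrite cardfs_eq0; apply/fset0Pn; exact: cf_F_neq0.
  have Cn0 := cf_cardC_gt0 n.
  rewrite !natrM invfM; field.
  by rewrite !pnatr_eq0 Pn0 Fn0 -lt0n Cn0.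
apply/eqP; rewrite eq_le measure_ge0 andbT; apply/lee_addgt0Pr => eps eps0; rewrite add0e.
have [k rk] : exists k, a - r k * a < eps.
  have : (a - r k * a) @[k --> \oo] --> (0 : R).
    rewrite -[X in _ --> X](subrr a) -[X in _ - X](mul1r a); apply: cvgB; first exact: cvg_cst.
    by apply: cvgMl; exact: (cond g n n0).
  by move=> /cvgr_lt/(_ _ eps0) /filter_ex.
apply: (@le_trans _ _ (mu (cf_cyl D n (F n) `\` cf_cyl D (n + k) (A k)))).
  by apply: le_measure; rewrite ?inE//; apply: measurableD => //; exact: mcyl.
have Xoo : (mu (cf_cyl D n (F n)) < +oo)%E by rewrite muX ltry.
have := @measureD _ _ _ mu _ _ (mcyl n (F n)) (mcyl (n + k)%N (A k)) Xoo.
rewrite setIidr// => XAE.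
apply: (@le_trans _ _ (mu (cf_cyl D n (F n)) - mu (cf_cyl D (n + k) (A k)))%E).
  by rewrite -XAE.
by rewrite muX muA -EFinB lee_fin ltW.
Qed.

Lemma cf_good_conull : mu (~` (cf_good D : set (cf_borel D))) = 0%E.
Proof.
apply/negligibleP; first by apply: measurableC; exact: cf_good_measurable.
rewrite goodE setC_bigcap; apply: negligible_bigcup => k.
(* Levels start at 1, as the standing assumption does; a point of X_0 is also a point of X_1. *)
apply: (@negligibleS _ _ _ mu (\bigcup_n (cf_cyl D n.+1 (F n.+1) `\` dom (ez k)))).
  move=> p np; have [n [x xp]] := cf_at_surj D p; exists n => //; split => //.
  have := cf_at_lift _ _ _ _ 1 xp; rewrite addn1 => yp.
  apply/cf_cylE; exists (cf_embed x) => //.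
  by have [] := cf_at_level _ _ _ _ yp.
apply: negligible_bigcup => n; apply/negligibleP; last exact: cf_dom_conull.
by apply: measurableD => //; exact: mcyl.
Qed.

Local Notation T := (cf_act D : int -> cf_borel D -> cf_borel D).

Lemma cf_act_cyl g n f : f \in F n -> (g + f)%R \in F n ->
  T g @^-1` cf_cyl D n [fset (g + f)%R]%fset `&` cf_good D =
  cf_cyl D n [fset f]%fset `&` cf_good D.
Proof.
move=> fF gF; apply/seteqP; split => p [Lp pg]; split => //.
  have := cf_moveN _ _ _ _ (cf_act_move _ g _ pg).
  rewrite -[f](addKr g); move: Lp; apply: cf_cyl_move => //.
  by rewrite addKr.
exact: cf_cyl_move fF gF Lp (cf_act_move _ g _ pg).
Qed.

(** The preimage of a cylinder consists of good points in cylinders whose g-translate lies inside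
    it, and of its own bad points, which [T g] fixes. *)
Lemma cf_act_measurable g : measurable_fun setT (T g).
Proof.
apply: (measurability _ (cf_borelE D)) => _ [A] [->|[n [f ->]]] <-.
  by rewrite preimage_set0 setI0.
rewrite setTI.
pose Q m f' := (g + f')%R \in F m /\
  cf_cyl D m [fset (g + f')%R]%fset `<=` cf_cyl D n [fset f]%fset.
rewrite (_ : T g @^-1` _ =
    (cf_good D `&` [set p | exists m f', Q m f' /\ cf_cyl D m [fset f']%fset p]) `|`
    (cf_cyl D n [fset f]%fset `\` cf_good D)).
  apply: measurableU.
    by apply: measurableI; [exact: cf_good_measurable|exact: measurable_choice].
  by apply: measurableD; [exact: mcyl|exact: cf_good_measurable].
apply/seteqP; split => [p|p [[pg [m [f' [[gF LL] Lp]]]]|[Lp pb]]].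
- have [pg|pb] := pselect (cf_good D p); last by rewrite /preimage /= cf_act_bad// => Lp; right.
  move=> Lq; left; split => //.
  have [m Hm] := cf_move_at _ _ _ _ (cf_act_move _ g _ pg).
  have [x [xp xq]] := Hm _ (leq_maxr n m).
  exists (maxn n m), (x 0%N); split; last by apply/cf_cylE; exists x => //; rewrite inE.
  split; first by have [] := cf_at_level _ _ _ _ xq.
  have Lq' : cf_cyl D (maxn n m) [fset (g + x 0%N)%R]%fset (cf_act D g p).
    by apply/cf_cylE; exists (cf_translate g x) => //; rewrite inE.
  rewrite -(subnKC (leq_maxl n m)) in Lq' *.
  exact: cf_cyl_nested Lq Lq'.
- apply: LL; apply: (cf_cyl_move _ _ _ _ _ _ _ gF Lp (cf_act_move _ g _ pg)).
  exact: cf_cyl_F Lp.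
- by rewrite /preimage /= cf_act_bad.
Qed.

Let mpre g A : measurable A -> measurable (T g @^-1` A).
Proof. by move=> mA; rewrite -[_ @^-1` _]setTI; exact: cf_act_measurable. Qed.

Local Notation G := (cf_good D : set (cf_borel D)).

Lemma cf_measure_good (A B : set (cf_borel D)) : measurable A -> measurable B ->
  A `&` G `<=` B -> (mu A <= mu B)%E.
Proof.
move=> mA mB AB; apply: (le_measure_null mu A B (~` G)) => //.
- by apply: measurableC; exact: cf_good_measurable.
- exact: cf_good_conull.
- by move=> p Ap; have [pg|pb] := pselect (G p); [left; apply: AB|right].
Qed.

Let mu_act_cyl g n f : f \in F n -> (g + f)%R \in F n ->
  mu (T g @^-1` cf_cyl D n [fset (g + f)%R]%fset) = mu (cf_cyl D n [fset (g + f)%R]%fset).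
Proof.
move=> fF gF; have E := cf_act_cyl g n f fF gF.
have mL k := mcyl n [fset k]%fset.
rewrite cf_measure_cyl1// -(cf_measure_cyl1 n f)//; apply/eqP; rewrite eq_le; apply/andP; split.
  apply: cf_measure_good; [exact: mpre|exact: mL|].
  by move=> p [Ap pg]; have [] : (cf_cyl D n [fset f]%fset `&` cf_good D) p by rewrite -E.
apply: cf_measure_good; [exact: mL|exact: mpre|].
move=> p [Ap pg].
by have [] : (T g @^-1` cf_cyl D n [fset (g + f)%R]%fset `&` cf_good D) p by rewrite E.
Qed.

Let mu_act_sub g n f m k : f \in F n -> (g + f)%R \in F n -> (n <= m)%N ->
  cf_cyl D m [fset k]%fset `<=` cf_cyl D n [fset (g + f)%R]%fset ->
  mu (T g @^-1` cf_cyl D m [fset k]%fset) = mu (cf_cyl D m [fset k]%fset).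
Proof.
move=> fF gF nm LL.
have [[p Lp]|nL] := pselect (exists p, cf_cyl D m [fset k]%fset p); last first.
  have -> : cf_cyl D m [fset k]%fset = set0 by rewrite -subset0 => p Lp; apply: nL; exists p.
  by rewrite preimage_set0.
have /cf_cylE[x xp] := LL _ Lp; rewrite inE => /eqP x0.
have xt : cf_level D n (cf_translate (- g) x).
  by have [_ xC] := cf_at_level _ _ _ _ xp; split => //=; rewrite x0 addKr.
have [kF _] := cf_level_embed _ _ (m - n) _ xt.
have xm := cf_at_lift _ _ _ _ (m - n) xp; rewrite subnKC// in kF xm *.
have kE : k = iter (m - n) cf_embed x 0%N.
  by move: Lp => /cf_cylE[y yp]; rewrite inE => /eqP <-; rewrite (cf_at_inj _ _ _ _ _ yp xm).
have gk : (g + (- g + k) = k)%R by rewrite addNKr.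
rewrite -gk; apply: mu_act_cyl; last by rewrite gk; exact: cf_cyl_F Lp.
by move: kF; rewrite iter_embed_translate /= -kE.
Qed.

(** Both sides are measures in A, finite on a countable cover by cylinders, so it suffices to
    compare them on the pi-system of cylinders, where each intersection with L is empty, L, or a
    cylinder inside L. *)
Let mu_act_restr g n f (A : set (cf_borel D)) :
  f \in F n -> (g + f)%R \in F n -> measurable A ->
  mu (T g @^-1` (A `&` cf_cyl D n [fset (g + f)%R]%fset)) =
  mu (A `&` cf_cyl D n [fset (g + f)%R]%fset).
Proof.
move=> fF gF mA; set L : set (cf_borel D) := cf_cyl D n _.
have mL : measurable (L : set (cf_borel D)) by exact: mcyl.
have [m1 m1E] := pullback_measure mu (T g) (T g @^-1` L) (cf_act_measurable g) (mpre g _ mL).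
have -> : mu (T g @^-1` (A `&` L)) = m1 A by rewrite m1E preimage_setI.
have -> : mu (A `&` L) = mrestr mu mL A by [].
pose cover k : set (cf_borel D) := cf_cyl D (e k).1 [fset (e k).2]%fset.
apply: (measure_unique (cf_cylinders D) cover (cf_borelE D) (cf_cylinders_setI D)) => //.
- by move=> k; right; exists (e k).1, (e k).2.
- apply/seteqP; split => // p _; have [m [x xp]] := cf_at_surj D p.
  exists (choice.pickle (m, x 0%N)) => //; rewrite /cover eK /=.
  by apply/cf_cylE; exists x => //; rewrite inE.
- move=> B BG; rewrite m1E -[RHS]/(mu (B `&` L)) -preimage_setI.
  move: BG => [->|[m [k ->]]]; first by rewrite set0I preimage_set0.
  have [[p [Bp Lp]]|nBL] := pselect (exists p, cf_cyl D m [fset k]%fset p /\ L p); last first.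
    have -> : cf_cyl D m [fset k]%fset `&` L = set0.
      by rewrite -subset0 => p [Bp Lp]; apply: nBL; exists p.
    by rewrite preimage_set0.
  have [nm|/ltnW mn] := leqP n m.
    have BL : cf_cyl D m [fset k]%fset `<=` L.
      by rewrite -(subnKC nm) in Bp *; exact: cf_cyl_nested Lp Bp.
    by rewrite setIidl//; exact: mu_act_sub BL.
  have LB : L `<=` cf_cyl D m [fset k]%fset.
    by rewrite /L -(subnKC mn) in Lp *; exact: cf_cyl_nested Bp Lp.
  by rewrite setIidr//; exact: mu_act_cyl.
- move=> k; rewrite m1E; apply: (@le_lt_trans _ _ (mu (T g @^-1` L))).
    apply: le_measure; rewrite ?inE; [|exact: mpre|by move=> p []].
    by apply: measurableI; apply: mpre => //; exact: mcyl.
  by rewrite mu_act_cyl//; exact: cf_measure_cyl1_lty.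
Qed.

(** Every good point is carried by -g within some level, hence lies in a cylinder over g + f with f
    and g + f in F_n. Making these countably many cylinders disjoint reduces the claim to one
    cylinder. *)
Lemma cf_act_preserves g (A : set (cf_borel D)) : measurable A -> mu (T g @^-1` A) = mu A.
Proof.
move=> mA.
pose E k : set (cf_borel D) :=
  if `[< (e k).2 \in F (e k).1 /\ (g + (e k).2)%R \in F (e k).1 >]
  then cf_cyl D (e k).1 [fset (g + (e k).2)%R]%fset else set0.
have mE k : measurable (E k).
  by rewrite /E; case: asboolP => // _; exact: mcyl.
have EA B k : measurable B -> mu (T g @^-1` (B `&` E k)) = mu (B `&` E k).
  move=> mB; rewrite /E; case: asboolP => [[fF gF]|_]; first exact: mu_act_restr.
  by rewrite setI0 preimage_set0.
have GE : G `<=` \bigcup_k E k.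
  move=> p pg; have [q] := pg (- g); rewrite cf_moveE => -[n [x [xp xq]]].
  exists (choice.pickle (n, (- g + x 0%N)%R)) => //; rewrite /E eK /=.
  case: asboolP => [_|[]].
    by apply/cf_cylE; exists x => //; rewrite addNKr inE.
  rewrite addNKr; split; first by have [] := cf_at_level _ _ _ _ xq.
  by have [] := cf_at_level _ _ _ _ xp.
pose H k := A `&` seqDU E k.
have mDU k : measurable (seqDU E k) by exact: seqDU_measurable.
have mH k : measurable (H k) by exact: measurableI.
have tH : trivIset setT H by apply: trivIset_setIl; exact: trivIset_seqDU.
have HE k : H k = H k `&` E k.
  by rewrite /H -setIA (setIidl (@subset_seqDU _ E k)).
have UH : \bigcup_k H k = A `&` \bigcup_k E k.
  by rewrite /H -setI_bigcupr -seqDU_bigcup_eq.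
have muH : mu (\bigcup_k H k) = mu (T g @^-1` \bigcup_k H k).
  rewrite preimage_bigcup measure_bigcup// measure_bigcup.
  - by apply: eq_eseriesr => k _; rewrite HE EA.
  - by move=> k _; exact: mpre.
  - apply/trivIsetP => i j _ _ ij; rewrite -preimage_setI.
    by move/trivIsetP: tH => /(_ i j I I ij) ->; rewrite preimage_set0.
have mUH : measurable (\bigcup_k H k) by exact: bigcupT_measurable.
have AH : mu A = mu (\bigcup_k H k).
  apply/eqP; rewrite eq_le; apply/andP; split.
    by apply: cf_measure_good => //; rewrite UH => p [Ap /GE].
  by apply: le_measure; rewrite ?inE// UH => p [].
rewrite AH muH; apply/eqP; rewrite eq_le; apply/andP; split.
  apply: cf_measure_good; [exact: mpre|exact: mpre|move=> p [Ap pg]].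
  by rewrite /preimage /= UH; split => //; apply: GE; apply/cf_act_good.
apply: le_measure; rewrite ?inE; [exact: mpre|exact: mpre|].
by rewrite UH => p [].
Qed.

Lemma cf_mp_action : mp_action mu T.
Proof.
split; [exact: cf_act_measurable|exact: cf_act0|exact: cf_actD|].
exact: cf_act_preserves.
Qed.

End CFMeasure.

(** * Towers of the (C,F)-action when each F_n is an interval *)

Section CFInterval.
Context {R : realType}.
Variables (D : cf_data) (h : nat -> nat) (mu : {measure set (cf_borel D) -> \bar R}).
Hypotheses (cond : cf_condition D R)
  (hF : forall n (z : int), (z \in cfF D n) = (0 <= z < (h n)%:Z))
  (muD : cf_measure mu).
Local Notation T := (cf_act D : int -> cf_borel D -> cf_borel D).
Local Notation G := (cf_good D : set (cf_borel D)).
Local Notation cyl0 := (cf_cyl D 0 [fset 0%R]%fset : set (cf_borel D)).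

Let actT : mp_action mu T := cf_mp_action D mu cond muD.
Let mG : measurable G := cf_good_measurable D.
Let mcyl n A : measurable (cf_cyl D n A : set (cf_borel D)) := cf_cyl_measurable D n A.

(** Bad points are fixed by the action, so the translates of an uncut cylinder would share them; on
    [G] the levels are exactly disjoint, and no measure changes. *)
Let Y : set (cf_borel D) := cyl0 `&` G.
Let P n : set (cf_borel D) := cf_cyl D n [fset 0%R]%fset `&` G.
Let S n : pred nat := fun j => j%:Z \in cf_sumset D 0 n.

Let h_gt0 n : (0 < h n)%N.
Proof. by have [f] := cf_F_neq0 D n; rewrite hF; lia. Qed.

(** As 0 lies in F_n, C_(n+1) is nonnegative; having two elements, it contains some c > 0, and h_n -
    1 + c lies in F_(n+1). *)
Lemma cf_height_lt n : (h n < h n.+1)%N.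
Proof.
have : (1 < #|` cfC D n.+1|)%N := cfC_gt1 D n.
have FC f c : f \in cfF D n -> c \in cfC D n.+1 -> f + c \in cfF D n.+1.
  by move=> fF cC; apply: (fsubsetP (cfFC_sub D n)); apply/imfset2P; exists f => //; exists c.
have F0 : 0 \in cfF D n by rewrite hF lexx /= ltz_nat.
have Fh : ((h n)%:Z - 1) \in cfF D n by rewrite hF; have := h_gt0 n; lia.
have C0 c : c \in cfC D n.+1 -> 0 <= c.
  by move=> /(FC _ _ F0); rewrite add0r hF => /andP[].
move=> C1; have [c cC c0] : exists2 c, c \in cfC D n.+1 & c != 0.
  apply: contrapT => nc; move: C1; apply/negP; rewrite -leqNgt.
  rewrite -(cardfs1 (0 : int)); apply: fsubset_leq_card; apply/fsubsetP => c cC.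
  by rewrite inE; apply: contrapT => /negP c0; apply: nc; exists c.
have := FC _ _ Fh cC; have := C0 _ cC; rewrite hF; lia.
Qed.

Let level_image n j : (j < h n)%N -> T j%:Z @` P n = cf_cyl D n [fset j%:Z]%fset `&` G.
Proof.
move=> jh; rewrite (act_imageE _ _ actT).
have jF : j%:Z \in cfF D n by rewrite hF; lia.
have := cf_act_cyl D (- j%:Z) n j%:Z jF; rewrite addNr hF lexx ltz_nat h_gt0 => /(_ isT) <-.
apply/seteqP; split => p [Lp pg]; split => //; last by apply/cf_act_good.
by move: pg => /cf_act_good.
Qed.

Let mP n : measurable (P n). Proof. exact: measurableI. Qed.

Let tP n : is_tower T (h n) (P n).
Proof.
apply/trivIsetP => i j /= ih jh ij; rewrite !level_image//.
rewrite -subset0 => p [[Lp _] [Lp' _]]; have := cf_cyl_disj _ _ _ _ _ Lp Lp'.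
by move=> [] /eqP; rewrite (negbTE ij).
Qed.

Let cyl0E n : cyl0 = cf_cyl D n (cf_sumset D 0 n).
Proof. by rewrite -(cf_cyl_sumset D 0 n) cfF0. Qed.

Let YE n : Y = \bigcup_(j in [set j | (j < h n)%N && S n j]) (T j%:Z @` P n).
Proof.
rewrite /Y (cyl0E n); apply/seteqP; split => p.
  move=> [/cf_cyl_bigcup[f fS Lp] pg].
  have fF := cf_cyl_F _ _ _ _ Lp; rewrite hF in fF.
  have fE : f = `|f|%N%:Z by lia.
  rewrite fE in fS Lp.
  have fh : (`|f|%N < h n)%N by lia.
  have fp : (T `|f|%N%:Z @` P n) p by rewrite level_image.
  by exists `|f|%N => //; rewrite /= fh.
move=> [j /andP[jh jS]]; rewrite level_image// => -[Lp pg]; split => //.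
by apply/cf_cyl_bigcup; exists j%:Z.
Qed.

Let mu_G (A : set (cf_borel D)) : measurable A -> mu (A `&` G) = mu A.
Proof.
move=> mA; apply/eqP; rewrite eq_le; apply/andP; split.
  by apply: le_measure; rewrite ?inE//; exact: measurableI.
by apply: (cf_measure_good D mu cond muD) => //; exact: measurableI.
Qed.

Let muY : mu Y = 1%E.
Proof.
rewrite mu_G// (cf_measure_cyl1 D mu muD) ?cfF0 ?inE//.
by rewrite /cf_cardC big_nil invr1.
Qed.

Let P0 : fine (mu (P n)) @[n --> \oo] --> (0 : R).
Proof.
have PE n : fine (mu (P n)) = (cf_cardC D n)%:R^-1.
  by rewrite mu_G// (cf_measure_cyl1 D mu muD)//= hF lexx ltz_nat h_gt0.
rewrite (_ : (fun n => _) = fun n => (cf_cardC D n)%:R^-1); last by apply/funext.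
apply/gtr0_cvgV0; first by apply: nearW => n; rewrite ltr0n cf_cardC_gt0.
apply/cvgryPge => A; near=> n.
apply: (@le_trans _ _ n%:R); first by near: n; exact: nbhs_infty_ger.
rewrite ler_nat; apply: leq_trans (cf_cardC_ge D n); apply: ltnW; exact: ltn_expl.
Unshelve. all: by end_near. Qed.

Let mTP n j : measurable (T j @` P n).
Proof. exact: (measurable_act_image _ _ actT). Qed.

Let approx (A : set (cf_borel D)) (e : R) : measurable A -> A `<=` Y -> 0 < e ->
  \forall n \near \oo, exists2 F : pred nat, {subset F <= S n} &
    (mu (A `+` \bigcup_(j in [set j | (j < h n)%N && F j]) (T j%:Z @` P n)) < e%:E)%E.
Proof.
rewrite (cf_borelE D).
apply: (sigma_algebra_approx mu Y (fun n j => T j%:Z @` P n) h S) => //.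
- exact: measurableI.
- by rewrite muY ltry.
- by move=> B [->//|[n [f ->]]]; exact: mcyl.
move=> B [->|[m [f ->]]].
  apply: nearW => n; exists pred0 => //.
  by rewrite set0I; apply/esym; rewrite -subset0 => x [j]; rewrite /= andbF.
exists m => // n /= mn.
(* The levels of Y meeting [f]_m; for n >= m nestedness puts each of them inside [f]_m. *)
exists (fun j => S n j &&
  `[< exists p, cf_cyl D m [fset f]%fset p /\ cf_cyl D n [fset j%:Z]%fset p >]).
  by move=> j /andP[].
apply/seteqP; split => p.
  move=> [Lp Yp]; move: (Yp); rewrite (YE n) => -[j /andP[jh Sj] jp]; exists j => //=.
  rewrite jh Sj /=; apply/asboolP; exists p; split => //.
  by move: jp; rewrite level_image// => -[].
move=> [j /andP[jh /andP[Sj /asboolP[q [Lq Lq']]]] jp].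
split; last by rewrite (YE n); exists j => //=; rewrite jh.
move: jp; rewrite level_image// => -[Lp _].
move: Lp; rewrite -(subnKC mn) in Lq' *.
exact: cf_cyl_nested Lq Lq' _.
Qed.

Let coverY : mu (~` \bigcup_(g : int) (T g @` Y)) = 0%E.
Proof.
have [mc null] : measurable (\bigcup_(g : int) (T g @` Y)) /\
    G `<=` \bigcup_(g : int) (T g @` Y).
  split.
    apply: countable_bigcupT_measurable => // g.
    by apply: (measurable_act_image _ _ actT); exact: measurableI.
  move=> p pg; have [n [x xp]] := cf_at_surj D p.
  have [x0F _] := cf_at_level _ _ _ _ xp.
  (* A good point with n-th coordinate x_0 is moved by f - x_0 to the level over f, which lies in
     [0]_0. *)
  have [f fS] : exists f, f \in cf_sumset D 0 n.
    have [q xq] := cf_atP D 0 _ (set_mem (cf_origin_subproof D)).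
    have : cyl0 q by apply/cf_cylE; exists (cf_origin_seq D) => //; rewrite inE.
    by rewrite (cyl0E n) => /cf_cyl_bigcup[f fS _]; exists f.
  have fF := fsubsetP (cf_sumset_sub D 0 n) _ fS.
  have Lp : cf_cyl D n [fset x 0%N]%fset p by apply/cf_cylE; exists x => //; rewrite inE.
  exists (x 0%N - f) => //; exists (T (f - x 0%N) p); last first.
    by rewrite -(opprB f) (actK _ _ actT).
  split; last by apply/cf_act_good.
  rewrite (cyl0E n); apply/cf_cyl_bigcup; exists f => //.
  have := cf_cyl_move D (f - x 0%N) n (x 0%N) p (T (f - x 0%N) p).
  by rewrite subrK; apply => //; exact: cf_act_move.
apply/eqP; rewrite eq_le measure_ge0 andbT -(cf_good_conull D mu cond muD).
by apply: le_measure; rewrite ?inE; [exact: measurableC|exact: measurableC|exact: subsetC].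
Qed.

Lemma cf_subseq_weakly_rationally_ergodic : subseq_weakly_rationally_ergodic mu T.
Proof.
exact: (cut_and_stack_subseq_weakly_rationally_ergodic mu T actT Y P h S muY mP tP YE P0
  approx coverY cf_height_lt).
Qed.

Lemma cf_ratio (A B : set (cf_borel D)) : measurable A -> measurable B ->
  A `<=` cyl0 -> B `<=` cyl0 ->
  corr_sum mu T (h l) A B / corr_sum mu T (h l) cyl0 cyl0 @[l --> \oo]
    --> fine (mu A) * fine (mu B).
Proof.
move=> mA mB AY BY.
have mI k (A' B' : set (cf_borel D)) : measurable A' -> measurable B' ->
    measurable (A' `&` T k @` B').
  by move=> mA' mB'; apply: measurableI => //; exact: (measurable_act_image _ _ actT).
have corrG l (A' B' : set (cf_borel D)) : measurable A' -> measurable B' ->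
    corr_sum mu T l A' B' = corr_sum mu T l (A' `&` G) (B' `&` G).
  move=> mA' mB'; apply: eq_bigr => k _; congr fine.
  have mAG := measurableI _ _ mA' mG; have mBG := measurableI _ _ mB' mG.
  apply/eqP; rewrite eq_le; apply/andP; split.
    apply: (cf_measure_good D mu cond muD) => //; [exact: mI|exact: mI|].
    move=> p [[Ap [z Bz zp]] pg]; split => //; exists z => //; split => //.
    by move: pg; rewrite -zp => /cf_act_good.
  apply: le_measure; rewrite ?inE; [exact: mI|exact: mI|].
  by move=> p [[Ap _] [z [Bz _] zp]]; split => //; exists z.
under eq_fun do rewrite corrG// [X in _ / X]corrG//.
rewrite -(mu_G A)// -(mu_G B)//.
apply: (cut_and_stack_ratio mu T actT Y P h S muY mP tP YE P0 approx).
- exact: measurableI.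
- exact: measurableI.
- by move=> p [/AY Yp pg].
- by move=> p [/BY Yp pg].
Qed.

End CFInterval.

Theorem theorem2p4 (R : realType) :
  (forall (D : cf_data) (h : nat -> nat)
      (mu : {measure set (cf_borel D) -> \bar R}),
    cf_condition D R ->
    (forall n (z : int), (z \in cfF D n) = (0 <= z < (h n)%:Z)) ->
    cf_measure mu ->
    (forall A B : set (cf_borel D), measurable A -> measurable B ->
       A `<=` cf_cyl D 0 [fset 0%R]%fset -> B `<=` cf_cyl D 0 [fset 0]%fset ->
       corr_sum mu (cf_act D) (h l) A B /
         corr_sum mu (cf_act D) (h l)
           (cf_cyl D 0 [fset 0%R]%fset) (cf_cyl D 0 [fset 0]%fset)
         @[l --> \oo] --> fine (mu A) * fine (mu B)) /\
    subseq_weakly_rationally_ergodic mu (cf_act D)) /\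
  (forall (d : measure_display) (X : measurableType d)
      (mu : {measure set X -> \bar R}) (T : int -> X -> X),
    standard_borel R X -> sigma_finite setT mu -> mp_action mu T ->
    rank_one mu T -> non_squashable mu T).
Proof.
split=> [D h mu cond hF muD|d X mu T _ sfX actT r1T].
  split=> [A B mA mB AY BY|].
    exact: cf_ratio.
  exact: cf_subseq_weakly_rationally_ergodic hF muD.
exact: rank_one_non_squashable.
Qed.
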